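(* Let $K$ be any field of characteristic different from $2$, let $K\langle x_1,\dots,x_n\rangle^{alg}$ be the ring of algebraic power series over $K$ with maximal ideal $\mathfrak m=\langle x_1,\dots,x_n\rangle$, and let $f\in\mathfrak m^2$ be an algebraic power series with $\operatorname{rank}H(f)=k$. Then $f$ is right equivalent, by an algebraic coordinate change (a $K$-algebra automorphism of $K\langle x_1,\dots,x_n\rangle^{alg}$), to $$a_1x_1^2+\dots+a_kx_k^2+g(x_{k+1},\dots,x_n),$$ with $a_i\in K$, $a_i\neq0$, where the residual part $g\in\mathfrak m^3$ is an algebraic power series. Moreover, $g$ is uniquely determined up to right equivalence in $K\langle x_{k+1},\dots,x_n\rangle^{alg}$.
   Context: An algebraic power series over $K$ is a formal power series $f\in K[[x_1,\dots,x_n]]$ for which there is a non-zero polynomial $P(x,t)\in K[x_1,\dots,x_n,t]$ with $P(x,f(x))=0$; these form the local ring $K\langle x_1,\dots,x_n\rangle^{alg}\subset K[[x_1,\dots,x_n]]$. Two algebraic power series $f,g$ are right equivalent in $K\langle x_1,\dots,x_n\rangle^{alg}$ if $\varphi(f)=g$ for some (local) $K$-algebra automorphism $\varphi$ of this ring, i.e. a substitution $x_i\mapsto\varphi_i$ with $\varphi_i\in\mathfrak m$ algebraic power series and invertible Jacobian determinant at $0$. $H(f)=\big(\frac{\partial^2f}{\partial x_i\partial x_j}(0)\big)_{i,j=1,\dots,n}$ is the Hessian matrix at $0$. *)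

(* Defs.v *)
From HB Require Import structures.
From mathcomp Require Import all_boot all_order all_algebra.
From mathcomp Require Import mpoly.
From mathcomp Require Import boolp.

Set Implicit Arguments.
Unset Strict Implicit.
Unset Printing Implicit Defensive.

Import GRing.Theory.
Local Open Scope ring_scope.

(* The ring K[[x_1, ..., x_n]]: a series is its family of coefficients,
   indexed by the monomials of the multinomials library. *)
Record fps (K : comNzRingType) (n : nat) :=
  Fps { fps_coef : 'X_{1..n} -> K }.

HB.instance Definition _ K n := [isNew for @fps_coef K n].
HB.instance Definition _ (K : comNzRingType) (n : nat) :=
  [Choice of fps K n by <:].

Section FpsRing.
Variables (K : comNzRingType) (n : nat).
Implicit Types (f g h : fps K n) (m : 'X_{1..n}).

Lemma fpsP f g : fps_coef f =1 fps_coef g <-> f = g.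
Proof. by split=> [e|->//]; apply: val_inj; apply: funext. Qed.

Definition fps_zero : fps K n := Fps (fun=> 0).
Definition fps_one : fps K n := Fps (fun m => (m == 0%MM)%:R).
Definition fps_opp f := Fps (fun m => - fps_coef f m).
Definition fps_add f g := Fps (fun m => fps_coef f m + fps_coef g m).
Definition fps_scale (c : K) f := Fps (fun m => c * fps_coef f m).

(* Cauchy product; the degree bounds only make the index type finite. *)
Definition fps_mul f g := Fps (fun m =>
  \sum_(k : 'X_{1..n < (mdeg m).+1, (mdeg m).+1} | m == (k.1 + k.2)%MM)
     fps_coef f k.1 * fps_coef g k.2).

Fact fps_addA : associative fps_add.
Proof. by move=> f g h; apply/fpsP=> m /=; rewrite addrA. Qed.
Fact fps_addC : commutative fps_add.
Proof. by move=> f g; apply/fpsP=> m /=; rewrite addrC. Qed.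
Fact fps_add0 : left_id fps_zero fps_add.
Proof. by move=> f; apply/fpsP=> m /=; rewrite add0r. Qed.
Fact fps_addN : left_inverse fps_zero fps_opp fps_add.
Proof. by move=> f; apply/fpsP=> m /=; rewrite addNr. Qed.

HB.instance Definition _ := GRing.isZmodule.Build (fps K n)
  fps_addA fps_addC fps_add0 fps_addN.

Definition fps_trunc N f : {mpoly K[n]} :=
  \sum_(m : 'X_{1..n < N}) fps_coef f m *: 'X_[m].

Lemma fps_truncE N f m : (mdeg m < N)%N -> (fps_trunc N f)@_m = fps_coef f m.
Proof. exact: mcoeff_mpoly. Qed.

Lemma mdegD_lt m m1 m2 N :
  (mdeg m < N)%N -> m = (m1 + m2)%MM -> (mdeg m1 < N)%N /\ (mdeg m2 < N)%N.
Proof.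
move=> + e; rewrite e mdegD => lt; split; apply: leq_ltn_trans lt.
- exact: leq_addr.
- exact: leq_addl.
Qed.

Lemma mcoeffM_fps N f g (p q : {mpoly K[n]}) m : (mdeg m < N)%N ->
    (forall m', (mdeg m' < N)%N -> p@_m' = fps_coef f m') ->
    (forall m', (mdeg m' < N)%N -> q@_m' = fps_coef g m') ->
  (p * q)@_m = fps_coef (fps_mul f g) m.
Proof.
move=> ltm ep eq; rewrite mcoeffM; apply: eq_bigr => k /eqP e.
have [l1 l2] := mdegD_lt ltm e.
by rewrite ep // eq.
Qed.

Fact fps_mulA : associative fps_mul.
Proof.
move=> f g h; apply/fpsP=> m; set N := (mdeg m).+1.
rewrite -(@mcoeffM_fps N _ _ (fps_trunc N f) (fps_trunc N g * fps_trunc N h)) //.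
- rewrite mulrA; apply: (@mcoeffM_fps N) => // m' lt; last exact: fps_truncE.
  by apply: (@mcoeffM_fps N) => // m'' ?; exact: fps_truncE.
- by move=> ? ?; exact: fps_truncE.
- by move=> m' lt; apply: (@mcoeffM_fps N) => // m'' ?; exact: fps_truncE.
Qed.

Fact fps_mulC : commutative fps_mul.
Proof.
move=> f g; apply/fpsP=> m; set N := (mdeg m).+1.
rewrite -(@mcoeffM_fps N _ _ (fps_trunc N f) (fps_trunc N g)) //.
- by rewrite mulrC; apply: (@mcoeffM_fps N) => // m' lt; exact: fps_truncE.
- by move=> ? ?; exact: fps_truncE.
- by move=> ? ?; exact: fps_truncE.
Qed.

Fact fps_mul1 : left_id fps_one fps_mul.
Proof.
move=> f; apply/fpsP=> m; set N := (mdeg m).+1.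
rewrite -(@mcoeffM_fps N _ _ 1 (fps_trunc N f)) //.
- by rewrite mul1r fps_truncE.
- by move=> m' _; rewrite mcoeff1.
- by move=> ? ?; exact: fps_truncE.
Qed.

Fact fps_mulDl : left_distributive fps_mul fps_add.
Proof.
move=> f g h; apply/fpsP=> m /=; rewrite -big_split /=.
by apply: eq_bigr => k _; rewrite mulrDl.
Qed.

Fact fps_one_neq0 : fps_one != fps_zero.
Proof.
apply/eqP=> /fpsP /(_ 0%MM) /= /eqP.
by rewrite eqxx oner_eq0.
Qed.

HB.instance Definition _ := GRing.Zmodule_isComNzRing.Build (fps K n)
  fps_mulA fps_mulC fps_mul1 fps_mulDl fps_one_neq0.

Fact fps_scaleA a b f : fps_scale a (fps_scale b f) = fps_scale (a * b) f.
Proof. by apply/fpsP=> m /=; rewrite mulrA. Qed.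
Fact fps_scale1 : left_id 1 fps_scale.
Proof. by move=> f; apply/fpsP=> m /=; rewrite mul1r. Qed.
Fact fps_scaleDr : right_distributive fps_scale +%R.
Proof. by move=> a f g; apply/fpsP=> m /=; rewrite mulrDr. Qed.
Fact fps_scaleDl f : {morph fps_scale^~ f : a b / a + b}.
Proof. by move=> a b; apply/fpsP=> m /=; rewrite mulrDl. Qed.

HB.instance Definition _ := GRing.Zmodule_isLmodule.Build K (fps K n)
  fps_scaleA fps_scale1 fps_scaleDr fps_scaleDl.

Fact fps_scaleAl (a : K) f g : a *: (f * g) = (a *: f) * g.
Proof.
apply/fpsP=> m /=; rewrite mulr_sumr.
by apply: eq_bigr => k _; rewrite mulrA.
Qed.

HB.instance Definition _ := GRing.Lmodule_isLalgebra.Build K (fps K n)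
  fps_scaleAl.
HB.instance Definition _ := GRing.Lalgebra_isComAlgebra.Build K (fps K n).

Lemma fps_coefM f g m N : (mdeg m < N)%N ->
  fps_coef (f * g) m = (fps_trunc N f * fps_trunc N g)@_m.
Proof.
by move=> lt; rewrite (@mcoeffM_fps N f g) // => m' ?; exact: fps_truncE.
Qed.

Definition fps_of_mpoly (p : {mpoly K[n]}) : fps K n := Fps (fun m => p@_m).

Fact fps_of_mpoly_zmod : zmod_morphism fps_of_mpoly.
Proof. by move=> p q; apply/fpsP=> m /=; rewrite mcoeffB. Qed.
Fact fps_of_mpoly_monoid : monoid_morphism fps_of_mpoly.
Proof.
split; first by apply/fpsP=> m /=; rewrite mcoeff1.
by move=> p q; apply/fpsP=> m /=; rewrite mcoeffM.
Qed.

HB.instance Definition _ := GRing.isZmodMorphism.Build {mpoly K[n]} (fps K n)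
  fps_of_mpoly fps_of_mpoly_zmod.
HB.instance Definition _ := GRing.isMonoidMorphism.Build {mpoly K[n]} (fps K n)
  fps_of_mpoly fps_of_mpoly_monoid.

Lemma fps_of_mpolyZ c p : fps_of_mpoly (c *: p) = c *: fps_of_mpoly p.
Proof. by apply/fpsP=> m /=; rewrite mcoeffZ. Qed.

Lemma fps_of_mpoly_inj : injective fps_of_mpoly.
Proof. by move=> p q e; apply/mpolyP=> m; move/fpsP/(_ m): e. Qed.

Definition fps_deriv (i : 'I_n) f : fps K n :=
  Fps (fun m => fps_coef f (m + U_(i))%MM *+ (m i).+1).

End FpsRing.

(* f is algebraic when P(x, f(x)) = 0 for some non-zero P in K[x][t]. *)
Definition fps_algebraic (K : fieldType) (n : nat) (f : fps K n) : Prop :=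
  exists2 P : {poly {mpoly K[n]}},
    P != 0 & root (map_poly (@fps_of_mpoly K n) P) f.

Section AlgebraicClosed.
Variables (K : fieldType) (n : nat).
Implicit Types (f g : fps K n).
Local Notation iota := (@fps_of_mpoly K n).

Lemma fps_algebraic_integral f :
  fps_algebraic f <-> exists2 c, c != 0 & integralOver iota (iota c * f).
Proof.
split=> [[P nzP /rootP rP] | [c nzc [Q monQ rQ]]].
  pose c := lead_coef P; pose d := (size P).-1.
  have nzc : c != 0 by rewrite lead_coef_eq0.
  have sP : size P = d.+1 by rewrite polySpred.
  exists c => //.
  have eP : \sum_(i < d.+1) iota P`_i * f ^+ i = 0.
    rewrite -[RHS]rP (@horner_coef_wide _ d.+1).
      by apply: eq_bigr => i _; rewrite coef_map.
    by rewrite -sP size_poly.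
  case ed: d => [|d'].
    have P0 : P`_0 = 0.
      apply: (@fps_of_mpoly_inj K n).
      by rewrite rmorph0; move: eP; rewrite ed big_ord1 expr0 mulr1.
    by move: nzc; rewrite /c lead_coefE -/d ed P0 eqxx.
  pose Q : {poly {mpoly K[n]}} := \poly_(i < d) (P`_i * c ^+ (d' - i)).
  exists ('X^d + Q).
    rewrite monicE lead_coefDl ?lead_coefXn //.
    by rewrite size_polyXn ltnS size_poly.
  apply/rootP; rewrite rmorphD /= map_polyXn hornerD hornerXn.
  have -> : (map_poly iota Q).[iota c * f] =
     \sum_(i < d) iota (P`_i) * iota c ^+ (d' - i) * (iota c * f) ^+ i.
    rewrite (@horner_coef_wide _ d); last first.
      by apply: leq_trans (size_poly _ _) _; exact: size_poly.
    apply: eq_bigr => i _; rewrite coef_map coef_poly ltn_ord /=.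
    by rewrite rmorphM rmorphXn.
  transitivity (iota c ^+ d' * \sum_(i < d.+1) iota P`_i * f ^+ i); last first.
    by rewrite eP mulr0.
  rewrite big_ord_recr /= mulrDr addrC; congr (_ + _).
    rewrite mulr_sumr; apply: eq_bigr => i _.
    have le : (i <= d')%N by rewrite -ltnS -ed.
    rewrite exprMn -{2}(subnK le) exprD -!mulrA mulrCA; congr (_ * _).
    by rewrite mulrCA.
  by rewrite {1}ed exprMn exprSr -{1}ed mulrA /c lead_coefE -mulrA.
exists (Q \Po (c *: 'X)).
  by rewrite comp_poly2_eq0 ?monic_neq0 // size_scale // size_polyX.
apply/rootP; rewrite map_comp_poly horner_comp /=.
suff -> : (map_poly iota (c *: 'X)).[f] = iota c * f by apply/rootP.
by rewrite linearZ /= map_polyX hornerZ hornerX.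
Qed.

Definition fps_alg_pred : {pred fps K n} := fun f => `[< fps_algebraic f >].

Lemma fps_algebraic_of_mpoly (p : {mpoly K[n]}) : iota p \in fps_alg_pred.
Proof.
apply/asboolP; exists ('X - p%:P); first by rewrite polyXsubC_eq0.
by rewrite rmorph_root ?root_XsubC.
Qed.

Fact fps_alg_subalg : GRing.subsemialg_closed fps_alg_pred.
Proof.
have alg0 : 0 \in fps_alg_pred.
  by rewrite -(rmorph0 iota) fps_algebraic_of_mpoly.
have algM : {in fps_alg_pred &, forall u v, u * v \in fps_alg_pred}.
  move=> f g /asboolP /fps_algebraic_integral [c nzc cf].
  move=> /asboolP /fps_algebraic_integral [d nzd dg].
  apply/asboolP/fps_algebraic_integral; exists (c * d); first by rewrite mulf_neq0.
  by rewrite rmorphM mulrACA; apply: integral_mul.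
split.
- by rewrite -(rmorph1 iota) fps_algebraic_of_mpoly.
- split=> // f g /asboolP /fps_algebraic_integral [c nzc cf].
  move=> /asboolP /fps_algebraic_integral [d nzd dg].
  apply/asboolP/fps_algebraic_integral; exists (c * d); first by rewrite mulf_neq0.
  have -> : iota (c * d) * (f + g) = iota d * (iota c * f) + iota c * (iota d * g).
    by rewrite rmorphM mulrDr mulrA (mulrC (iota d)) -mulrA -[in X in _ + X]mulrA.
  by apply: integral_add; apply: integral_mul => //; apply: integral_id.
- move=> a f algf; rewrite -[f]mul1r scalerAl.
  by rewrite -(rmorph1 iota) -fps_of_mpolyZ algM // fps_algebraic_of_mpoly.
- exact: algM.
Qed.

End AlgebraicClosed.

HB.instance Definition _ (K : fieldType) (n : nat) :=
  GRing.isSubalgClosed.Build K (fps K n) (@fps_alg_pred K n)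
    (@fps_alg_subalg K n).

Record algps (K : fieldType) (n : nat) :=
  AlgPs { algps_val :> fps K n; _ : algps_val \in @fps_alg_pred K n }.

HB.instance Definition _ K n := [isSub for @algps_val K n].
HB.instance Definition _ (K : fieldType) (n : nat) :=
  [Choice of algps K n by <:].
HB.instance Definition _ (K : fieldType) (n : nat) :=
  [SubChoice_isSubAlgebra of algps K n by <:].
HB.instance Definition _ (K : fieldType) (n : nat) :=
  [SubNzRing_isSubComNzRing of algps K n by <:].

Definition algps_X (K : fieldType) (n : nat) (i : 'I_n) : algps K n :=
  AlgPs (fps_algebraic_of_mpoly ('X_i : {mpoly K[n]})).

(* No locality is required of phi: a ring automorphism of a local ring is
   automatically local. *)
Definition right_equiv (K : fieldType) (n : nat) (f g : algps K n) : Prop :=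
  exists2 phi : {lrmorphism algps K n -> algps K n},
    bijective phi & phi f = g.

Section Ideals.
Variable A : comNzRingType.

Definition idealM (I J : A -> Prop) : A -> Prop := fun f =>
  exists (N : nat) (a b : 'I_N -> A),
    (forall i, I (a i) /\ J (b i)) /\ f = \sum_(i < N) a i * b i.

Fixpoint idealX (I : A -> Prop) (d : nat) : A -> Prop :=
  if d is d'.+1 then idealM I (idealX I d') else fun=> True.

End Ideals.

Definition max_ideal (K : fieldType) (n : nat) : algps K n -> Prop := fun f =>
  exists h : 'I_n -> algps K n, f = \sum_(i < n) h i * algps_X K i.

Definition hessian (K : fieldType) (n : nat) (f : fps K n) : 'M[K]_n :=
  \matrix_(i, j) fps_coef (fps_deriv i (fps_deriv j f)) 0%MM.

(* Series in the last n - k variables, seen as series in n variables: the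
   0-based variable j of the former is the variable k + j of the latter. *)
Section Tail.
Variables (n k : nat).

Fact tail_ord_subproof (j : 'I_(n - k)) : (k + j < n)%N.
Proof. by rewrite -ltn_subRL. Qed.

Definition tail_ord (j : 'I_(n - k)) : 'I_n := Ordinal (tail_ord_subproof j).

Definition tail_mnm (m : 'X_{1..n}) : 'X_{1..(n - k)} :=
  [multinom m (tail_ord j) | j < n - k].

Definition is_tail_mnm (m : 'X_{1..n}) : bool :=
  [forall i : 'I_n, (i < k)%N ==> (m i == 0%N)].

Definition fps_tail (K : comNzRingType) (g : fps K (n - k)) : fps K n :=
  Fps (fun m => if is_tail_mnm m then fps_coef g (tail_mnm m) else 0).

Let ext_mnm (a : 'X_{1..(n - k)}) : 'X_{1..n} :=
  (\sum_(j < n - k) U_(tail_ord j) *+ a j)%MM.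

Let tail_ord_inj : injective tail_ord.
Proof. by move=> i j /(congr1 val) /= /addnI /val_inj. Qed.

Let ext_mnm_tail a j : ext_mnm a (tail_ord j) = a j.
Proof.
rewrite /ext_mnm mnm_sumE (bigD1 j) //= mulmnE mnm1E eqxx mul1n big1 ?addn0 //.
move=> i ne; rewrite mulmnE mnm1E (inj_eq tail_ord_inj).
by rewrite (negbTE ne) mul0n.
Qed.

Let ext_mnm_is_tail a : is_tail_mnm (ext_mnm a).
Proof.
apply/forallP=> i; apply/implyP=> lt; apply/eqP.
rewrite /ext_mnm mnm_sumE big1 // => j _; rewrite mulmnE mnm1E.
case: eqP => [e|]; last by rewrite mul0n.
by move: lt; rewrite -e /= ltnNge leq_addr.
Qed.

Let ext_mnm_eq a m : (ext_mnm a == m) = is_tail_mnm m && (a == tail_mnm m).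
Proof.
apply/eqP/andP => [<-|[t /eqP ->]].
  split; first exact: ext_mnm_is_tail.
  by apply/eqP/mnmP=> j; rewrite mnmE ext_mnm_tail.
apply/mnmP=> i; have [lt|ge] := ltnP i k.
  have /forallP /(_ i) := ext_mnm_is_tail (tail_mnm m).
  move/forallP: t => /(_ i); rewrite lt /= => /eqP -> /eqP -> //.
have lt : (i - k < n - k)%N by rewrite ltn_sub2r // (leq_ltn_trans ge).
have -> : i = tail_ord (Ordinal lt) by apply: val_inj; rewrite /= subnKC.
by rewrite ext_mnm_tail mnmE.
Qed.

Let mdeg_tail m : (mdeg (tail_mnm m) <= mdeg m)%N.
Proof.
rewrite !mdegE.
have -> : (\sum_i tail_mnm m i = \sum_(i in [set tail_ord j | j : 'I_(n - k)]) m i)%N.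
  rewrite big_imset /=; last by move=> ? ? _ _; exact: tail_ord_inj.
  by apply: eq_big => // j _; rewrite mnmE.
by rewrite [X in (_ <= X)%N](bigID (mem [set tail_ord j | j : 'I_(n - k)])) leq_addr.
Qed.

Variable K : fieldType.

Definition mpoly_tail : {mpoly K[n - k]} -> {mpoly K[n]} :=
  mmap (@mpolyC n K) (fun j => 'X_(tail_ord j)).

HB.instance Definition _ := GRing.RMorphism.copy mpoly_tail
  (mmap (@mpolyC n K) (fun j => 'X_(tail_ord j))).

Lemma mcoeff_tail p m :
  (mpoly_tail p)@_m = if is_tail_mnm m then p@_(tail_mnm m) else 0.
Proof.
have renX a : mpoly_tail 'X_[a] = 'X_[ext_mnm a].
  rewrite /mpoly_tail mmapX /mmap1 /ext_mnm -mprodXE.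
  by apply: eq_bigr => j _; rewrite mpolyXn.
rewrite [in LHS](mpolyE p) rmorph_sum raddf_sum /=.
under eq_bigr => a _.
  rewrite -mul_mpolyC rmorphM /= {1}/mpoly_tail mmapC -/mpoly_tail renX mul_mpolyC mcoeffZ.
  rewrite mcoeffX ext_mnm_eq.
  over.
case: ifP => t /=; last by rewrite big1 // => a _; rewrite mulr0.
rewrite [in RHS](mpolyE p) raddf_sum /=.
by apply: eq_bigr => a _; rewrite mcoeffZ mcoeffX.
Qed.

Lemma mpoly_tail_inj : injective mpoly_tail.
Proof.
move=> p q e; apply/mpolyP=> a; move/mpolyP/(_ (ext_mnm a)): e.
rewrite !mcoeff_tail ext_mnm_is_tail.
suff -> : tail_mnm (ext_mnm a) = a by [].
by apply/mnmP=> j; rewrite mnmE ext_mnm_tail.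
Qed.

Fact fps_tail_zmod : zmod_morphism (@fps_tail K).
Proof.
by move=> f g; apply/fpsP=> m /=; case: ifP; rewrite ?subr0.
Qed.

Fact fps_tail_monoid : monoid_morphism (@fps_tail K).
Proof.
split=> [|f g]; apply/fpsP=> m.
  by have := mcoeff_tail 1 m; rewrite /mpoly_tail rmorph1 !mcoeff1 /= => ->.
pose N := (mdeg m).+1; pose T (h : fps K (n - k)) := fps_trunc N h.
have lt : (mdeg (tail_mnm m) < N)%N by rewrite ltnS mdeg_tail.
transitivity (mpoly_tail (T f * T g))@_m.
  by rewrite mcoeff_tail /= -(fps_coefM _ _ lt).
have renT h m' : (mdeg m' < N)%N -> (mpoly_tail (T h))@_m' = fps_coef (fps_tail h) m'.
  move=> lt'; rewrite mcoeff_tail /=; case: ifP => // _; rewrite fps_truncE //.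
  exact: leq_ltn_trans (mdeg_tail _) lt'.
rewrite rmorphM /= (@mcoeffM_fps _ _ N (fps_tail f) (fps_tail g)) // => m' lt';
  exact: renT.
Qed.

HB.instance Definition _ := GRing.isZmodMorphism.Build
  (fps K (n - k)) (fps K n) (@fps_tail K) fps_tail_zmod.
HB.instance Definition _ := GRing.isMonoidMorphism.Build
  (fps K (n - k)) (fps K n) (@fps_tail K) fps_tail_monoid.

Fact algps_tail_subproof (g : algps K (n - k)) :
  fps_tail g \in @fps_alg_pred K n.
Proof.
case: g => g /= /asboolP [P nzP rP]; apply/asboolP.
exists (map_poly mpoly_tail P).
  rewrite -size_poly_eq0 size_map_inj_poly ?rmorph0 ?size_poly_eq0 //.
  exact: mpoly_tail_inj.
have -> : map_poly (@fps_of_mpoly K n) (map_poly mpoly_tail P)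
        = map_poly (@fps_tail K) (map_poly (@fps_of_mpoly K (n - k)) P).
  rewrite -!map_poly_comp; apply: eq_map_poly => p /=.
  by apply/fpsP=> m /=; rewrite mcoeff_tail.
by move/rootP: rP => rP; apply/rootP; rewrite horner_map /= rP rmorph0.
Qed.

Definition algps_tail (g : algps K (n - k)) : algps K n :=
  AlgPs (algps_tail_subproof g).

End Tail.

(* a_1 x_1^2 + ... + a_k x_k^2 + g(x_(k+1), ..., x_n). Indices are 0-based, and
   only the values a i with i < k are used. *)
Definition split_form (K : fieldType) (n k : nat) (a : 'I_n -> K)
    (g : algps K (n - k)) : algps K n :=
  \sum_(i < n | (i < k)%N) a i *: algps_X K i ^+ 2 + algps_tail g.

Definition is_splitting (K : fieldType) (n k : nat) (f : algps K n)
    (a : 'I_n -> K) (g : algps K (n - k)) : Prop :=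
  [/\ forall i : 'I_n, (i < k)%N -> a i != 0,
      idealX (@max_ideal K (n - k)) 3 g
    & right_equiv f (split_form a g)].

(* Main.v *)
Require Import Defs.
From HB Require Import structures.
From mathcomp Require Import all_boot all_order all_algebra.
From mathcomp Require Import mpoly boolp.

Set Implicit Arguments.
Unset Strict Implicit.
Unset Printing Implicit Defensive.

Import GRing.Theory.
Local Open Scope ring_scope.

(** The splitting lemma rests on two facts about algebraic power series: they
    are stable under substitution, and a change of coordinates by algebraic
    series has an algebraic inverse.

    Stability ([fps_alg_subst]). If P(y, f) = 0 and phi is substituted for y,
    the polynomial P(phi, t) may vanish, so nothing can be read off at once.
    The translate f(y + phi(x)), a series in y and x, causes no such trouble:
    the translation is injective because x = 0 undoes it, so P(y + phi(x), t) is
    a non-zero equation with algebraic coefficients, and algebraicity is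
    transitive ([fps_alg_trans]). Setting y = 0 gives f(phi(x)); for this the
    equation is first divided by y as often as possible ([fps_alg_drop1]).

    Inversion ([fps_alg_inverse_function]). Coordinates are straightened one at
    a time. If only the coordinate i of phi is not a variable, then
    P(x, phi_i) = 0 becomes, in the new coordinates, P(psi, x_i) = 0, which is
    an equation for the single unknown coordinate psi_i of the inverse psi;
    so psi_i is algebraic. As every automorphism of the ring is local, hence
    given by substitution ([algps_morph_subst]), right equivalence is
    substitution of algebraic series with an invertible Jacobian matrix
    ([right_equivP]).

    Existence. Let f have Hessian diag(d) with exactly the first k entries
    non-zero, as can be achieved by a linear change. Expanding f(x + v) and
    dividing by the variables v twice gives f + sum v_i b_i + sum v_i v_j c_ij
    with algebraic b and c ([fps_alg_taylor]); the b_i are the derivatives,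
    obtained without differentiating an equation, which might be inseparable.
    The linear parts of the b_i are the rows of the Hessian, so the equations
    b_i = 0 for i < k define a graph over the remaining variables. Translating
    to it turns f into g(x_(k+1), ..., x_n) + sum_(i, j < k) x_i x_j c_ij
    ([fps_alg_critical]). The symmetric matrix of the c_ij is diagonal at the
    origin, and completing squares over the local ring, which has square roots of
    series with constant term 1, makes it constant ([algps_cholesky],
    [fps_alg_diagonalize]).

    Uniqueness ([splitting_unique]). Let phi take q + g to q' + g', where q and
    q' are the diagonal forms in the first k variables, and let L be its linear
    part, so that q' = q(L). Where phi_i = - L_i for all i < k, the value
    q(phi) equals q(- L) = q', hence g(phi) = g'. Since phi_i + L_i has linear
    part 2 L_i, this locus is a graph over the last n - k variables, and
    restricting phi to it gives the coordinate change from g to g'. *)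

(** * Order of vanishing *)

Section Order.
Variables (K : fieldType) (n : nat).
Implicit Types (f g h : fps K n) (m : 'X_{1..n}).

Definition fps_ord d f := forall m, (mdeg m < d)%N -> fps_coef f m = 0.

Definition fps_X (i : 'I_n) : fps K n := fps_of_mpoly 'X_i.

Lemma fps_coefD f g m : fps_coef (f + g) m = fps_coef f m + fps_coef g m.
Proof. by []. Qed.

Lemma fps_coefN f m : fps_coef (- f) m = - fps_coef f m.
Proof. by []. Qed.

Lemma fps_coefB f g m : fps_coef (f - g) m = fps_coef f m - fps_coef g m.
Proof. by []. Qed.

Lemma fps_coefZ c f m : fps_coef (c *: f) m = c * fps_coef f m.
Proof. by []. Qed.

Lemma fps_coef1 m : fps_coef (1 : fps K n) m = (m == 0%MM)%:R.
Proof. by []. Qed.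

Lemma fps_coef_sum I (r : seq I) (P : pred I) (F : I -> fps K n) m :
  fps_coef (\sum_(i <- r | P i) F i) m = \sum_(i <- r | P i) fps_coef (F i) m.
Proof. by elim/big_rec2: _ => // i x y _ <-. Qed.

Lemma fps_coefX i m : fps_coef (fps_X i) m = (m == U_(i)%MM)%:R.
Proof. by rewrite /= mcoeffX eq_sym. Qed.

Lemma fps_coef_trunc N f m :
  (fps_trunc N f)@_m = if (mdeg m < N)%N then fps_coef f m else 0.
Proof.
case: ltnP => [/fps_truncE->//|le].
rewrite raddf_sum big1 //= => -[m' /= lt] _.
rewrite mcoeffZ mcoeffX; case: eqP => [e|]; last by rewrite mulr0.
by move: lt; rewrite e ltnNge le.
Qed.

Lemma fps_ordW d e f : (d <= e)%N -> fps_ord e f -> fps_ord d f.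
Proof. by move=> le of_ m lt; apply: of_; exact: leq_trans le. Qed.

Lemma fps_ord_eq0 f : (forall d, fps_ord d f) -> f = 0.
Proof. by move=> o; apply/fpsP=> m; exact: (o (mdeg m).+1). Qed.

Lemma fps_ord_eq f g : (forall d, fps_ord d (f - g)) -> f = g.
Proof. by move=> /fps_ord_eq0 /subr0_eq. Qed.

Lemma fps_ord00 d : fps_ord d (0 : fps K n).
Proof. by []. Qed.

Lemma fps_ord0 f : fps_ord 0 f.
Proof. by []. Qed.

Lemma fps_ordD d f g : fps_ord d f -> fps_ord d g -> fps_ord d (f + g).
Proof. by move=> F G m lt; rewrite fps_coefD F // G // addr0. Qed.

Lemma fps_ordN d f : fps_ord d f -> fps_ord d (- f).
Proof. by move=> F m lt; rewrite fps_coefN F // oppr0. Qed.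

Lemma fps_ordB d f g : fps_ord d f -> fps_ord d g -> fps_ord d (f - g).
Proof. by move=> F G; apply: fps_ordD => //; exact: fps_ordN. Qed.

Lemma fps_ordBC d f g : fps_ord d (f - g) -> fps_ord d (g - f).
Proof. by move/fps_ordN; rewrite opprB. Qed.

Lemma fps_ord_trans d g f h :
  fps_ord d (f - g) -> fps_ord d (g - h) -> fps_ord d (f - h).
Proof. by move=> F G; have := fps_ordD F G; rewrite addrA subrK. Qed.

Lemma fps_ordZ d c f : fps_ord d f -> fps_ord d (c *: f).
Proof. by move=> F m lt; rewrite fps_coefZ F // mulr0. Qed.

Lemma fps_ord_sum I (r : seq I) (P : pred I) (F : I -> fps K n) d :
  (forall i, P i -> fps_ord d (F i)) -> fps_ord d (\sum_(i <- r | P i) F i).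
Proof.
move=> o; elim/big_rec: _ => [|i x Pi ox]; first exact: fps_ord00.
by apply: fps_ordD => //; exact: o.
Qed.

Lemma fps_ordM d e f g : fps_ord d f -> fps_ord e g -> fps_ord (d + e) (f * g).
Proof.
move=> F G m lt; rewrite [LHS]big1 // => -[k1 k2] /= /eqP /(congr1 (@mdeg n)) e12.
have {}lt : (mdeg k1 + mdeg k2 < d + e)%N by rewrite -mdegD -e12.
have [lt1|le1] := ltnP (mdeg k1) d; first by rewrite F ?mul0r.
have [lt2|le2] := ltnP (mdeg k2) e; first by rewrite G ?mulr0.
by move: lt; rewrite ltnNge leq_add.
Qed.

Lemma fps_ordMl d f g : fps_ord d f -> fps_ord d (f * g).
Proof. by move=> F; rewrite -(addn0 d); exact: fps_ordM F (fps_ord0 g). Qed.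

Lemma fps_ordMr d f g : fps_ord d g -> fps_ord d (f * g).
Proof. by rewrite mulrC; exact: fps_ordMl. Qed.

Lemma fps_ordX f d e : fps_ord d f -> fps_ord (e * d) (f ^+ e).
Proof.
by move=> F; elim: e => [|e IH] //; rewrite mulSn exprS; exact: fps_ordM.
Qed.

Lemma fps_ord1P f : fps_ord 1 f <-> fps_coef f 0%MM = 0.
Proof.
split=> [o|e m]; first by apply: o; rewrite mdeg0.
by rewrite ltnS leqn0 mdeg_eq0 => /eqP->.
Qed.

Lemma fps_ord_X i : fps_ord 1 (fps_X i).
Proof.
by apply/fps_ord1P; rewrite fps_coefX eq_sym -mdeg_eq0 mdeg1.
Qed.

Lemma fps_coefM0 f g :
  fps_coef (f * g) 0%MM = fps_coef f 0%MM * fps_coef g 0%MM.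
Proof.
have lt : (mdeg (0%MM : 'X_{1..n}) < 1)%N by rewrite mdeg0.
have e h : fps_trunc 1 h = (fps_coef h 0%MM)%:MP.
  apply/mpolyP=> m; rewrite fps_coef_trunc mcoeffC ltnS leqn0 mdeg_eq0.
  by case: eqP => [->|]; rewrite ?mulr1 ?mulr0.
by rewrite (fps_coefM _ _ lt) !e mcoeffCM mcoeffC eqxx mulr1.
Qed.

Lemma fps_truncB N f : fps_ord N (f - fps_of_mpoly (fps_trunc N f)).
Proof. by move=> m lt; rewrite fps_coefB /= fps_truncE ?subrr. Qed.

Lemma fps_coefXM i h m : fps_coef (fps_X i * h) m =
  if m i == 0%N then 0 else fps_coef h (m - U_(i))%MM.
Proof.
have lt := ltnSn (mdeg m); rewrite mulrC (fps_coefM _ _ lt).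
have [e|mi] := eqVneq (m i) 0%N.
  rewrite mcoeffM big1 // => -[k1 k2] /= /eqP em.
  rewrite [X in _ * X]fps_coef_trunc fps_coefX.
  case: eqP => [ek|]; last by rewrite if_same mulr0.
  by move/mnmP/(_ i): em; rewrite ek mnmDE mnm1E eqxx addn1 e.
have sub : (U_(i) <= m)%MM.
  by apply/mnm_lepP=> j; rewrite mnm1E; case: eqP => // <-; rewrite lt0n.
have eX : fps_trunc (mdeg m).+1 (fps_X i) = 'X_[U_(i)].
  apply/mpolyP=> k; rewrite fps_coef_trunc fps_coefX mcoeffX eq_sym.
  case: eqP => [<-|]; last by rewrite if_same.
  by rewrite mdeg1 ltnS lt0n mdeg_eq0; case: (m =P 0%MM) => // e; move: mi; rewrite e mnm0E.
rewrite eX -{1}(submK sub) addmC mcoeffMX fps_truncE // ltnS.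
exact: mdegB.
Qed.

(** The quotient by the variable [i], after dropping the monomials that do not
    contain it. *)
Definition fps_shift i f : fps K n := Fps (fun m => fps_coef f (m + U_(i))%MM).

Lemma fps_ord_shift i d f : fps_ord d.+1 f -> fps_ord d (fps_shift i f).
Proof. by move=> F m lt; apply: F; rewrite mdegD mdeg1 addn1. Qed.

Lemma fps_X_cancel i f : fps_X i * f = 0 -> f = 0.
Proof.
move=> e; apply/fpsP=> m; have := congr1 (fun g => fps_coef g (m + U_(i))%MM) e.
by rewrite fps_coefXM mnmDE mnm1E eqxx addn1 /= addmK.
Qed.

End Order.

Arguments fps_X {K n} i.

(** * Substitution *)

(** Only families without constant term can be substituted into arbitrary
    series, so the side condition is bundled with the family. *)
Record psub (K : fieldType) (m n : nat) := Psub {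
  psub_val :> 'I_m -> fps K n;
  psub_ord : forall i, fps_ord 1 (psub_val i) }.

Lemma subrACA (V : zmodType) (x y z t : V) :
  (x - y) - (z - t) = (x - z) - (y - t).
Proof. by rewrite !opprD addrACA. Qed.

Section Eval.
Variables (K : fieldType) (m n : nat).

Definition fps_eval (phi : 'I_m -> fps K n) : {mpoly K[m]} -> fps K n :=
  mmap (in_alg (fps K n)) phi.

HB.instance Definition _ (phi : 'I_m -> fps K n) :=
  GRing.RMorphism.copy (fps_eval phi) (mmap (in_alg (fps K n)) phi).

Lemma fps_evalZ phi c p : fps_eval phi (c *: p) = c *: fps_eval phi p.
Proof. by rewrite /fps_eval mmapZ /= mulr_algl. Qed.

Lemma fps_evalX phi i : fps_eval phi 'X_i = phi i.
Proof. by rewrite /fps_eval mmapX mmap1U. Qed.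

Variable phi : psub K m n.

Lemma fps_ord_eval N p : (forall a, (mdeg a < N)%N -> p@_a = 0) ->
  fps_ord N (fps_eval phi p).
Proof.
move=> p0; rewrite [p]mpolyE rmorph_sum /= big_seq; apply: fps_ord_sum => a ap.
rewrite fps_evalZ; apply: fps_ordZ.
have le : (N <= mdeg a)%N.
  by rewrite leqNgt; apply/negP=> /p0 /eqP; rewrite mcoeff_eq0 ap.
apply: fps_ordW le _; rewrite mdegE /fps_eval mmapX /mmap1.
elim/big_rec2: _ => // i x d _ ox.
by apply: fps_ordM => //; have := @fps_ordX _ _ _ _ (a i) (psub_ord phi i); rewrite muln1.
Qed.

End Eval.

(** The coefficient at [a] only depends on the terms of degree at most
    [mdeg a] because substituted series vanish at the origin. *)
HB.lock Definition fps_subst (K : fieldType) (m n : nat) (phi : psub K m n)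
    (f : fps K m) : fps K n :=
  Fps (fun a => fps_coef (fps_eval phi (fps_trunc (mdeg a).+1 f)) a).

Section Subst.
Variables (K : fieldType) (m n : nat) (phi : psub K m n).
Local Notation fps_subst := (fps_subst phi).

Lemma fps_coef_subst f a : fps_coef (fps_subst f) a =
  fps_coef (fps_eval phi (fps_trunc (mdeg a).+1 f)) a.
Proof. by rewrite fps_subst.unlock. Qed.

Lemma fps_subst_eval N f p : fps_ord N (f - fps_of_mpoly p) ->
  fps_ord N (fps_subst f - fps_eval phi p).
Proof.
move=> o a lt; rewrite fps_coefB fps_coef_subst -fps_coefB -rmorphB.
apply: (@fps_ord_eval _ _ _ phi (mdeg a).+1) => // b; rewrite ltnS => le.
rewrite mcoeffB fps_coef_trunc ltnS le.
by have := o b (leq_ltn_trans le lt); rewrite fps_coefB.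
Qed.

Lemma fps_subst_trunc N f :
  fps_ord N (fps_subst f - fps_eval phi (fps_trunc N f)).
Proof. exact/fps_subst_eval/fps_truncB. Qed.

Lemma fps_subst_of_mpoly p : fps_subst (fps_of_mpoly p) = fps_eval phi p.
Proof. by apply: fps_ord_eq => d; apply: fps_subst_eval; rewrite subrr. Qed.

Lemma fps_ord_subst d f : fps_ord d f -> fps_ord d (fps_subst f).
Proof.
move=> o; have := @fps_subst_eval d f 0; rewrite !rmorph0 !subr0.
exact.
Qed.

Fact fps_subst_zmod : zmod_morphism fps_subst.
Proof.
move=> f g; apply: fps_ord_eq => d; apply: (@fps_ord_trans _ _ _
  (fps_eval phi (fps_trunc d f - fps_trunc d g))).
  apply: fps_subst_eval; rewrite rmorphB subrACA.
  by apply: fps_ordB; exact: fps_truncB.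
by apply: fps_ordBC; rewrite rmorphB subrACA; apply: fps_ordB; exact: fps_subst_trunc.
Qed.

HB.instance Definition _ := GRing.isZmodMorphism.Build
  (fps K m) (fps K n) fps_subst fps_subst_zmod.

Lemma fps_ord_mulB k d (f f' g g' : fps K k) :
  fps_ord d (f - f') -> fps_ord d (g - g') -> fps_ord d (f * g - f' * g').
Proof.
move=> F G; have -> : f * g - f' * g' = (f - f') * g + f' * (g - g').
  by rewrite mulrBl mulrBr addrA subrK.
by apply: fps_ordD; [exact: fps_ordMl | exact: fps_ordMr].
Qed.

Fact fps_subst_monoid : monoid_morphism fps_subst.
Proof.
split; first by rewrite -(rmorph1 (@fps_of_mpoly K m)) fps_subst_of_mpoly rmorph1.
move=> f g; apply: fps_ord_eq => d; apply: (@fps_ord_trans _ _ _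
  (fps_eval phi (fps_trunc d f * fps_trunc d g))).
  by apply: fps_subst_eval; rewrite rmorphM; apply: fps_ord_mulB; exact: fps_truncB.
apply: fps_ordBC; rewrite rmorphM; apply: fps_ord_mulB; exact: fps_subst_trunc.
Qed.

HB.instance Definition _ := GRing.isMonoidMorphism.Build
  (fps K m) (fps K n) fps_subst fps_subst_monoid.

Fact fps_subst_scalable : scalable fps_subst.
Proof.
move=> c f; apply/fpsP => a; rewrite fps_coefZ !fps_coef_subst -fps_coefZ -fps_evalZ; congr fps_coef.
congr fps_eval; apply/mpolyP=> b; rewrite mcoeffZ !fps_coef_trunc.
by case: ifP; rewrite ?mulr0.
Qed.

HB.instance Definition _ := GRing.isScalable.Build
  K (fps K m) (fps K n) *:%R fps_subst fps_subst_scalable.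

Lemma fps_substX i : fps_subst (fps_X i) = phi i.
Proof. by rewrite fps_subst_of_mpoly fps_evalX. Qed.

(** The two sides agree on polynomials, and polynomials are dense for the order
    of vanishing. *)
Lemma fps_subst_unique (theta : {lrmorphism fps K m -> fps K n}) :
  (forall d f, fps_ord d f -> fps_ord d (theta f)) ->
  (forall i, theta (fps_X i) = phi i) -> theta =1 fps_subst.
Proof.
move=> cont gen f; apply: fps_ord_eq => d.
apply: fps_ord_trans (fps_ordBC (@fps_subst_trunc d f)).
have -> : fps_eval phi (fps_trunc d f) = theta (fps_of_mpoly (fps_trunc d f)).
  elim/mpolyind: (fps_trunc d f) => [|c a p _ _ IH]; first by rewrite !rmorph0.
  rewrite !rmorphD /= IH; congr (_ + _).
  rewrite fps_evalZ fps_of_mpolyZ linearZ /=; congr (_ *: _).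
  rewrite [X in fps_of_mpoly X]mpolyXE_id !rmorph_prod /fps_eval mmapX /mmap1.
  by apply: eq_bigr => i _; rewrite !rmorphXn /= gen.
by rewrite -rmorphB; apply: cont; exact: fps_truncB.
Qed.

End Subst.

Lemma fps_subst_comp (K : fieldType) (l m n : nat) (phi : psub K l m)
    (psi : psub K m n) (chi : psub K l n) :
  (forall i, fps_subst psi (phi i) = chi i) ->
  forall f, fps_subst psi (fps_subst phi f) = fps_subst chi f.
Proof.
move=> e f.
pose theta : {lrmorphism fps K l -> fps K n} := fps_subst psi \o fps_subst phi.
rewrite -[LHS]/(theta f); apply: fps_subst_unique => [d g o | i].
  by do 2!apply: fps_ord_subst.
by rewrite /theta /= fps_substX e.
Qed.

Lemma eq_fps_subst (K : fieldType) (m n : nat) (phi psi : psub K m n) :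
  phi =1 psi -> fps_subst phi =1 fps_subst psi.
Proof.
move=> e f; pose theta : {lrmorphism fps K m -> fps K n} := fps_subst phi.
rewrite -[LHS]/(theta f); apply: fps_subst_unique => [d g|i].
  exact: fps_ord_subst.
by rewrite /theta /= fps_substX e.
Qed.

Section IdSubst.
Variables (K : fieldType) (n : nat).

Definition psub_id : psub K n n := Psub (@fps_ord_X K n).

Lemma fps_subst_id f : fps_subst psub_id f = f.
Proof.
apply: esym; pose theta : {lrmorphism fps K n -> fps K n} := idfun.
by rewrite -[LHS]/(theta f); apply: fps_subst_unique.
Qed.

End IdSubst.

Lemma fps_subst_eqid (K : fieldType) (n : nat) (phi : psub K n n) :
  (forall i, phi i = fps_X i) -> fps_subst phi =1 id.
Proof. by move=> e f; rewrite -[RHS]fps_subst_id; apply: eq_fps_subst. Qed.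

(** A left inverse need only be checked on the variables. *)
Lemma fps_subst_cancel (K : fieldType) (m n : nat) (phi : psub K m n)
    (psi : psub K n m) :
  (forall i, fps_subst psi (phi i) = fps_X i) ->
  cancel (fps_subst phi) (fps_subst psi).
Proof.
by move=> e f; rewrite (@fps_subst_comp _ _ _ _ _ _ (psub_id K m)) ?fps_subst_id.
Qed.

Section Domain.
Variables (K : fieldType) (n : nat).
Implicit Types (f g : fps K n).

Lemma fps_initial_form f : f != 0 -> exists d (p : {mpoly K[n]}),
  [/\ p != 0, p \is d.-homog, fps_ord d f & fps_ord d.+1 (f - fps_of_mpoly p)].
Proof.
move=> nz; pose P d := `[< exists2 m, mdeg m = d & fps_coef f m != 0 >].
have exP : exists d, P d.
  have /existsNP[m /eqP nzm] : ~ forall m, fps_coef f m = 0.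
    by move=> e; case/eqP: nz; apply/fpsP.
  by exists (mdeg m); apply/asboolP; exists m.
have [d /asboolP[m md nzm] dmin] := ex_minnP exP.
have od : fps_ord d f.
  move=> a lt; apply/eqP; apply: contraLR lt => nza; rewrite -leqNgt.
  by apply: dmin; apply/asboolP; exists a.
exists d, (fps_trunc d.+1 f); split=> //; last exact: fps_truncB.
- apply: contraNneq nzm => /(congr1 (mcoeff m)).
  by rewrite mcoeff0 fps_coef_trunc md ltnSn => ->.
apply/dhomogP=> a; rewrite mcoeff_msupp fps_coef_trunc ltnS.
have [le|] := leqP (mdeg a) d; last by rewrite eqxx.
by move=> nza; apply/eqP; rewrite eqn_leq le leqNgt; apply: contraNN nza => /od->.
Qed.

(** The initial form of a product is the product of the initial forms, and
    polynomials over a field have no zero divisors. *)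
Lemma fps_mulf_eq0 f g : f * g = 0 -> g != 0 -> f = 0.
Proof.
move=> fg nzg; apply/eqP; apply: contraT => nzf.
have [d [p [nzp hp of_ ofp]]] := fps_initial_form nzf.
have [e [q [nzq hq og ogq]]] := fps_initial_form nzg.
suff pq0 : p * q = 0 by move/eqP: pq0; rewrite mulf_eq0 (negbTE nzp) (negbTE nzq).
have o : fps_ord (d + e).+1 (fps_of_mpoly (p * q)).
  have op : fps_ord d (fps_of_mpoly p).
    have -> : fps_of_mpoly p = f - (f - fps_of_mpoly p) by rewrite subKr.
    by apply: fps_ordB => //; apply: fps_ordW ofp.
  rewrite -[fps_of_mpoly _]opprK -[X in - X]sub0r -fg rmorphM.
  have -> : f * g - fps_of_mpoly p * fps_of_mpoly q =
      (f - fps_of_mpoly p) * g + fps_of_mpoly p * (g - fps_of_mpoly q).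
    by rewrite mulrBl mulrBr addrA subrK.
  apply: fps_ordN; apply: fps_ordD; first by rewrite -addSn; apply: fps_ordM.
  by rewrite -addnS; apply: fps_ordM.
apply/mpolyP=> m; rewrite mcoeff0.
have [le|lt] := leqP (mdeg m) (d + e); first exact: (o m).
by apply: (dhomog_nemf_coeff (dhomogM hp hq)); rewrite neq_ltn lt orbT.
Qed.

End Domain.

(** * Linear parts *)

Section Linear.
Variables (K : fieldType).

Definition jac m n (phi : psub K m n) : 'M[K]_(m, n) :=
  \matrix_(i, j) fps_coef (phi i) U_(j)%MM.

Lemma fps_ord_linear n (f : fps K n) : fps_ord 1 f ->
  fps_ord 2 (f - \sum_i fps_coef f U_(i)%MM *: fps_X i).
Proof.
move=> o a; rewrite ltnS fps_coefB fps_coef_sum.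
under eq_bigr => i _ do rewrite fps_coefZ fps_coefX.
rewrite leq_eqVlt ltnS leqn0 => /orP[/mdeg1P[i /eqP ->] | /eqP a0]; last first.
  rewrite o ?a0 // sub0r big1 ?oppr0 // => i _.
  by case: eqP a0 => [->|_ _]; rewrite ?mdeg1 ?mulr0.
rewrite (bigD1 i) //= eqxx mulr1 big1 ?addr0 ?subrr // => j ne.
rewrite (_ : U_(i)%MM == _ = false) ?mulr0 //.
by apply/eqP=> /mnmP/(_ j); rewrite !mnm1E eqxx eq_sym (negbTE ne).
Qed.

Lemma fps_linear_subst m n (phi : psub K m n) f j : fps_ord 1 f ->
  fps_coef (fps_subst phi f) U_(j)%MM =
  \sum_i fps_coef f U_(i)%MM * fps_coef (phi i) U_(j)%MM.
Proof.
move=> /fps_ord_linear /(fps_ord_subst phi) /(_ U_(j)%MM).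
rewrite mdeg1 => /(_ isT); rewrite rmorphB fps_coefB rmorph_sum /= fps_coef_sum.
move/eqP; rewrite subr_eq0 => /eqP ->; apply: eq_bigr => i _.
by rewrite linearZ /= -fps_coefZ fps_substX.
Qed.

Lemma jac_comp l m n (phi : psub K l m) (psi : psub K m n) (chi : psub K l n) :
  (forall i, fps_subst psi (phi i) = chi i) -> jac chi = jac phi *m jac psi.
Proof.
move=> e; apply/matrixP=> i j; rewrite !mxE -e fps_linear_subst; last exact: psub_ord.
by apply: eq_bigr => p _; rewrite !mxE.
Qed.

Lemma fps_coefXU n (i j : 'I_n) : fps_coef (fps_X i : fps K n) U_(j)%MM = (i == j)%:R.
Proof. by rewrite [LHS]mcoeffXU. Qed.

Lemma jac_id n : jac (psub_id K n) = 1%:M.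
Proof. by apply/matrixP=> i j; rewrite !mxE; exact: mcoeffXU. Qed.


End Linear.

(** * Division by variables *)

Section Division.
Variables (K : fieldType) (n : nat).
Implicit Types (f h : fps K n) (S : pred 'I_n).

Fact kill_subproof S i : fps_ord 1 (if S i then 0 else fps_X i : fps K n).
Proof. by case: ifP => _; [exact: fps_ord00 | exact: fps_ord_X]. Qed.

Definition kill S : psub K n n := Psub (kill_subproof S).

Lemma fps_subst_fix (phi : psub K n n) f :
    (forall a i, fps_coef f a != 0 -> a i != 0%N -> phi i = fps_X i) ->
  fps_subst phi f = f.
Proof.
move=> fixX; apply: fps_ord_eq => d.
apply: (fps_ord_trans (fps_subst_trunc phi f (N := d))).
suff -> : fps_eval phi (fps_trunc d f) = fps_of_mpoly (fps_trunc d f).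
  exact/fps_ordBC/fps_truncB.
rewrite [fps_trunc d f]mpolyE !rmorph_sum /= big_seq [RHS]big_seq.
apply: eq_bigr => a; rewrite mcoeff_msupp fps_coef_trunc.
case: ifP => _; last by rewrite eqxx.
move=> nza; rewrite fps_evalZ fps_of_mpolyZ; congr (_ *: _).
rewrite [in RHS]mpolyXE_id rmorph_prod /fps_eval mmapX /mmap1.
apply: eq_bigr => i _; rewrite rmorphXn /=.
by have [->|nzi] := eqVneq (a i) 0%N; rewrite ?expr0 // (fixX _ _ nza nzi).
Qed.

(** What remains after subtracting the multiple of the variable [i] does not
    contain that variable, so the substitution fixes it. *)
Lemma fps_kill1 i f : f = fps_subst (kill (pred1 i)) f + fps_X i * fps_shift i f.
Proof.
set h := fps_shift i f; set phi := kill _.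
have e : fps_subst phi (f - fps_X i * h) = f - fps_X i * h.
  apply: fps_subst_fix => a j nz nzj /=; case: eqP => // ej; case/eqP: nz.
  rewrite fps_coefB fps_coefXM -{1}ej (negbTE nzj) /= submK ?subrr //.
  apply/mnm_lepP=> l; rewrite mnm1E; case: eqP => //= <-; rewrite -ej lt0n //.
have e0 : fps_subst phi (fps_X i * h) = 0.
  by rewrite rmorphM /= fps_substX /= eqxx mul0r.
by rewrite -{1}(subrK (fps_X i * h) f) -e rmorphB /= e0 subr0.
Qed.

(** The variables of [S] are set to zero one after the other, and each step
    changes the series by a multiple of one variable. The multiplier is the
    quotient found at step [i], where the variables of [S] before [i] are
    already gone. *)
Definition fps_divX S (i : 'I_n) f : fps K n :=
  fps_shift i (fps_subst (kill [pred j : 'I_n | S j && (j < i)%N]) f).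

Lemma fps_ord_divX S i d f : fps_ord d.+1 f -> fps_ord d (fps_divX S i f).
Proof. by move=> o; apply: fps_ord_shift; exact: fps_ord_subst. Qed.

Lemma fps_kill_step S (i : 'I_n) f :
  fps_subst (kill [pred j : 'I_n | S j && (j < i)%N]) f =
  fps_subst (kill [pred j : 'I_n | S j && (j < i.+1)%N]) f
    + (if S i then fps_X i * fps_divX S i f else 0).
Proof.
case: ifP => Si.
  set A := kill _; set B := kill _.
  suff <- : fps_subst (kill (pred1 i)) (fps_subst A f) = fps_subst B f.
    exact: fps_kill1.
  apply: fps_subst_comp => j /=.
  case: ifP => [/andP[-> lt]|H]; first by rewrite rmorph0 ltnS (ltnW lt).
  rewrite fps_substX /=; have [->|ne] := eqVneq j i; first by rewrite Si ltnSn.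
  by rewrite ltnS leq_eqVlt (inj_eq val_inj) (negbTE ne) H.
rewrite addr0; apply: eq_fps_subst => j /=; rewrite ltnS [in RHS]leq_eqVlt (inj_eq val_inj).
by have [->|] := eqVneq j i; rewrite ?Si.
Qed.

Lemma fps_divXP S f : f = fps_subst (kill S) f +
  \sum_(i | S i) fps_X i * fps_divX S i f.
Proof.
pose E t := fps_subst (kill [pred j : 'I_n | S j && (j < t)%N]) f.
have E0 : E 0%N = f by apply: fps_subst_eqid => i /=; rewrite andbF.
have En : E n = fps_subst (kill S) f.
  by apply: eq_fps_subst => i /=; rewrite ltn_ord andbT.
apply/eqP; rewrite addrC -subr_eq -{1}E0 -En -opprB -(telescope_sumr E (leq0n n)).
rewrite big_mkord -sumrN [in eqbRHS]big_mkcond; apply/eqP/eq_bigr => i _ /=.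
by rewrite opprB {1}/E fps_kill_step addrAC subrr add0r.
Qed.

End Division.

Lemma fps_ord_subC (K : fieldType) n (f : fps K n) :
  fps_ord 1 (f - (fps_coef f 0%MM)%:A).
Proof.
by apply/fps_ord1P; rewrite fps_coefB fps_coefZ fps_coef1 eqxx mulr1 subrr.
Qed.

Lemma fps_subst_coef0 (K : fieldType) m n (phi : psub K m n) f :
  fps_coef (fps_subst phi f) 0%MM = fps_coef f 0%MM.
Proof.
have /(fps_ord_subst phi)/fps_ord1P := fps_ord_subC f.
rewrite rmorphB fps_coefB /= rmorph_alg fps_coefZ fps_coef1 eqxx mulr1.
by move/eqP; rewrite subr_eq0 => /eqP.
Qed.

(** All series in no variables are constant, so the substitution of zeros
    factors through constants. *)
Lemma fps_subst0 (K : fieldType) m n (phi : psub K m n) f :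
  (forall i, phi i = 0) -> fps_subst phi f = (fps_coef f 0%MM)%:A.
Proof.
move=> phi0.
pose psi : psub K m 0 := Psub (fun _ => @fps_ord00 K _ 1).
pose chi : psub K 0 n := Psub (fun _ => @fps_ord00 K _ 1).
rewrite -(@fps_subst_comp _ _ _ _ psi chi) => [|i]; last by rewrite rmorph0 phi0.
have -> : fps_subst psi f = (fps_coef f 0%MM)%:A.
  apply/fpsP=> a; have -> : a = 0%MM by apply/mnmP; case.
  by rewrite fps_subst_coef0 fps_coefZ fps_coef1 eqxx mulr1.
by rewrite /= rmorph_alg.
Qed.

Lemma fps_ord1_divXP (K : fieldType) n (f : fps K n) : fps_ord 1 f ->
  f = \sum_i fps_X i * fps_divX predT i f.
Proof.
move=> /fps_ord1P f0; rewrite {1}(fps_divXP predT f) fps_subst0 //.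
by rewrite f0 scale0r add0r.
Qed.

(** A local morphism is continuous, since a series vanishing to order [d] is
    a sum of products of [d] variables with other series. *)
Lemma fps_morph_subst (K : fieldType) m n (phi : psub K m n)
    (theta : {lrmorphism fps K m -> fps K n}) :
  (forall i, theta (fps_X i) = phi i) -> theta =1 fps_subst phi.
Proof.
move=> eX f; apply: fps_ord_eq => d; elim: d f => [|d IH] f //.
pose c := fps_coef f 0%MM; have oc : fps_ord 1 (f - c%:A) by exact: fps_ord_subC.
rewrite -(subrK c%:A f) (fps_ord1_divXP oc) !rmorphD /= !rmorph_alg.
rewrite opprD addrACA subrr addr0 !rmorph_sum -sumrB; apply: fps_ord_sum => i _.
set h := fps_divX _ _ _; rewrite !rmorphM /= fps_substX eX -mulrBr -add1n.
by apply: fps_ordM; [exact: psub_ord | exact: IH].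
Qed.

(** * Fixed points *)

Section FixedPoint.
Variables (K : fieldType) (n : nat) (T : fps K n -> fps K n).
Hypothesis T1 : forall u, fps_ord 1 u -> fps_ord 1 (T u).
Hypothesis T_contract : forall d u v, (0 < d)%N -> fps_ord 1 u -> fps_ord 1 v ->
  fps_ord d (u - v) -> fps_ord d.+1 (T u - T v).

(** Each iteration from 0 settles the coefficients of one more degree. *)
Lemma fps_fixpoint : exists2 u, fps_ord 1 u & T u = u.
Proof.
pose U N := iter N T 0.
have U1 N : fps_ord 1 (U N) by elim: N => [|N IH] //=; apply: T1.
have Ustep N : fps_ord N.+1 (U N.+1 - U N).
  by elim: N => [|N IH]; [exact: fps_ordB (U1 1%N) (U1 0%N) | exact: T_contract (ltn0Sn N) (U1 _) (U1 _) IH].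
have Ule M N : (M <= N)%N -> fps_ord M.+1 (U N - U M).
  elim: N => [|N IH]; first by rewrite leqn0 => /eqP->; rewrite subrr.
  rewrite leq_eqVlt => /orP[/eqP->|]; first by rewrite subrr.
  rewrite ltnS => le; apply: fps_ord_trans (IH le).
  by apply: fps_ordW (Ustep N); rewrite ltnS.
pose u := Fps (fun m => fps_coef (U (mdeg m)) m).
have uU N : fps_ord N.+1 (u - U N).
  move=> m; rewrite ltnS => le; rewrite fps_coefB /=.
  have := Ule _ _ le m (ltnSn _); rewrite fps_coefB => /eqP.
  by rewrite subr_eq0 => /eqP->; rewrite subrr.
have u1 : fps_ord 1 u by rewrite -[u]subr0; exact: uU 0%N.
exists u => //; apply: fps_ord_eq => d.
apply: (@fps_ord_trans _ _ d (U d.+1)); last first.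
  by apply: fps_ordBC; apply: fps_ordW (uU d.+1); rewrite ltnW.
have -> : U d.+1 = T (U d) by [].
have := T_contract (ltn0Sn d) u1 (U1 d) (uU d).
by apply: fps_ordW; rewrite ltnW.
Qed.

End FixedPoint.

Section Units.
Variables (K : fieldType) (n : nat).
Implicit Types (f g : fps K n).

Lemma fps_inverse f : fps_coef f 0%MM != 0 -> exists g, f * g = 1.
Proof.
move=> nz; pose c := fps_coef f 0%MM; pose h := 1 - c^-1 *: f.
have h1 : fps_ord 1 h.
  apply/fps_ord1P; rewrite fps_coefB fps_coef1 eqxx fps_coefZ.
  by rewrite mulVf // subrr.
have [u _ e] : exists2 u, fps_ord 1 u & h + h * u = u.
  apply: fps_fixpoint => [u _|d u v _ _ _ o].
    by apply: fps_ordD => //; exact: fps_ordMl.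
  rewrite opprD addrACA subrr add0r -mulrBr -add1n; exact: fps_ordM.
exists (c^-1 *: (1 + u)); rewrite -scalerAr scalerAl.
have -> : c^-1 *: f = 1 - h by rewrite subKr.
by rewrite mulrBl mul1r mulrDr mulr1 e addrK.
Qed.

Lemma fps_sqrt f : (2%:R : K) != 0 -> fps_coef f 0%MM = 1 ->
  exists2 s, fps_coef s 0%MM = 1 & s ^+ 2 = f.
Proof.
move=> nz2 f1; pose h := f - 1.
have h1 : fps_ord 1 h.
  by apply/fps_ord1P; rewrite fps_coefB fps_coef1 eqxx f1 subrr.
have [u u1 e] : exists2 u, fps_ord 1 u & 2%:R^-1 *: (h - u ^+ 2) = u.
  apply: fps_fixpoint => [u u1|d u v _ u1 v1 o]; first apply: fps_ordZ.
    by apply: fps_ordB => //; rewrite expr2; exact: fps_ordMl.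
  rewrite -scalerBr subrACA subrr sub0r; apply/fps_ordZ/fps_ordN.
  by rewrite subr_sqr -addn1; apply: fps_ordM => //; exact: fps_ordD.
exists (1 + u).
  by rewrite fps_coefD fps_coef1 eqxx (fps_ord1P u).1 // addr0.
rewrite sqrrD expr1n mul1r -addrA -scaler_nat -{1}e scalerA divff // scale1r.
by rewrite subrK /h addrC subrK.
Qed.

End Units.

(** * Inverting a change of one coordinate *)

Section Inverse.
Variable (K : fieldType).

(** By induction on the order, with the difference of a product [X_i * g] written
    as (phi_i - psi_i) g(phi) + psi_i (g(phi) - g(psi)). *)
Lemma fps_subst_ord_diff m n (phi psi : psub K m n) d f :
  (forall i, fps_ord d (phi i - psi i)) ->
  fps_ord d (fps_subst phi f - fps_subst psi f).
Proof.
move=> o; suff H e h : (e <= d)%N -> fps_ord e (fps_subst phi h - fps_subst psi h).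
  exact: H.
elim: e h => [|e IH] h led //; pose c := (fps_coef h 0%MM)%:A : fps K m.
have -> : fps_subst phi h - fps_subst psi h =
          fps_subst phi (h - c) - fps_subst psi (h - c).
  by rewrite !rmorphB /= !rmorph_alg subrACA subrr subr0.
rewrite (fps_ord1_divXP (fps_ord_subC h)) !rmorph_sum -sumrB.
apply: fps_ord_sum => i _; rewrite !rmorphM /= !fps_substX.
set g := fps_divX _ _ _.
rewrite -(subrK (psi i * fps_subst phi g) (phi i * _)) -mulrBl -addrA -mulrBr.
apply: fps_ordD; first by apply: fps_ordMl; exact: fps_ordW led (o i).
rewrite -add1n; apply: fps_ordM; [exact: psub_ord | exact/IH/ltnW].
Qed.

(** Composing with [phi] changes a series without linear part by a term of
    higher order than the change in [phi]; this is what makes the iteration for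
    the inverse converge. *)
Lemma fps_subst_ord2_diff m n (phi psi : psub K m n) d f : fps_ord 2 f ->
  (forall i, fps_ord d (phi i - psi i)) ->
  fps_ord d.+1 (fps_subst phi f - fps_subst psi f).
Proof.
move=> o2 o; rewrite (fps_ord1_divXP (fps_ordW (leqnSn 1) o2)) !rmorph_sum -sumrB.
apply: fps_ord_sum => i _; rewrite !rmorphM /= !fps_substX.
have := fps_ord_divX predT i o2; set g := fps_divX _ _ _ => g1.
rewrite -(subrK (psi i * fps_subst phi g) (phi i * _)) -mulrBl -addrA -mulrBr.
apply: fps_ordD; first by rewrite -addn1; apply: fps_ordM => //; exact: fps_ord_subst.
by rewrite -add1n; apply: fps_ordM; [exact: psub_ord | exact: fps_subst_ord_diff].
Qed.

Fact upd_subproof n (phi : psub K n n) i u (ou : fps_ord 1 u) j :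
  fps_ord 1 (if j == i then u else phi j).
Proof. by case: ifP => // _; exact: psub_ord. Qed.

Definition psub_upd n (phi : psub K n n) i u ou : psub K n n :=
  Psub (@upd_subproof n phi i u ou).

(** With [phi i = X_i + r] and [r] of order 2, the coordinate [i] of the inverse is
    the fixed point of [u |-> X_i - r(u)], where [u] is put in place of [X_i]. *)
Lemma fps_inverse_coord n (phi : psub K n n) i : jac phi = 1%:M ->
    (forall j, j != i -> phi j = fps_X j) ->
  exists psi : psub K n n, [/\ forall j, j != i -> psi j = fps_X j, jac psi = 1%:M
    & forall j, fps_subst psi (phi j) = fps_X j].
Proof.
move=> jac1 phiX; pose r := phi i - fps_X i.
have r2 : fps_ord 2 r.
  have := fps_ord_linear (psub_ord phi i); rewrite (bigD1 i) //= big1 => [|j ne].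
    by move/matrixP/(_ i i): jac1; rewrite !mxE eqxx addr0 => ->; rewrite scale1r.
  by move/matrixP/(_ i j): jac1; rewrite !mxE eq_sym (negbTE ne) => ->; rewrite scale0r.
pose sub u := if pselect (fps_ord 1 u) is left ou
  then psub_upd (psub_id K n) i ou else psub_id K n.
have subE u j : fps_ord 1 u -> sub u j = if j == i then u else fps_X j.
  by rewrite /sub; case: pselect.
have [u u1 eu] : exists2 u, fps_ord 1 u & fps_X i - fps_subst (sub u) r = u.
  apply: fps_fixpoint => [u u1|d u v d0 u1 v1 o].
    apply: fps_ordB; first exact: fps_ord_X.
    by apply: fps_ord_subst; apply: fps_ordW r2.
  rewrite subrACA subrr sub0r; apply/fps_ordN/fps_subst_ord2_diff => // j.
  by rewrite !subE //; case: ifP => // _; rewrite subrr; exact: fps_ord00.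
have inv j : fps_subst (sub u) (phi j) = fps_X j.
  have [->|ne] := eqVneq j i; last by rewrite phiX // fps_substX subE // (negbTE ne).
  rewrite -[phi i](subrK (fps_X i)) -/r rmorphD /= fps_substX subE // eqxx.
  by rewrite -{2}eu addrC subrK.
exists (sub u); split=> // [j ne|]; first by rewrite subE // (negbTE ne).
by rewrite -[jac _]mul1mx -jac1 -(jac_comp (chi := psub_id K n)) ?jac_id.
Qed.

End Inverse.

(** * Algebraic series *)

Local Notation fps_alg := (@fps_alg_pred _ _).

Section Algebraic.
Variables (K : fieldType) (n : nat).
Implicit Types (f g : fps K n) (Q : {poly fps K n}).
Local Notation iota := (@fps_of_mpoly K n).

Lemma fps_alg_mpoly p : iota p \in fps_alg.
Proof. exact: fps_algebraic_of_mpoly. Qed.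

Lemma fps_algX (i : 'I_n) : fps_X i \in @fps_alg_pred K n.
Proof. exact: fps_alg_mpoly. Qed.

Lemma fps_alg_eval m (phi : 'I_m -> fps K n) p :
  (forall i, phi i \in fps_alg) -> fps_eval phi p \in fps_alg.
Proof.
move=> aphi; rewrite [p]mpolyE rmorph_sum /= rpred_sum // => a _.
rewrite fps_evalZ rpredZ // /fps_eval mmapX /mmap1 rpred_prod // => i _.
by rewrite rpredX.
Qed.

Lemma fps_alg_mulIl c f : c != 0 -> iota c * f \in fps_alg -> f \in fps_alg.
Proof.
move=> nzc /asboolP/fps_algebraic_integral[d nzd int].
apply/asboolP/fps_algebraic_integral; exists (d * c); first by rewrite mulf_neq0.
by rewrite rmorphM -mulrA.
Qed.

Lemma fps_alg_horner Q f : (forall j, Q`_j \in fps_alg) -> f \in fps_alg ->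
  Q.[f] \in fps_alg.
Proof.
by move=> aQ af; rewrite horner_coef rpred_sum // => j _; rewrite rpredM ?rpredX.
Qed.

(** The polynomial [c] is the constant coefficient of an equation for [f] from
    which all factors ['X] have been removed; this is possible as [f] is not a
    zero divisor. *)
Lemma fps_alg_multiple f : f \in fps_alg -> f != 0 ->
  exists2 g, g \in fps_alg & exists2 c, c != 0 & g * f = iota c.
Proof.
move=> af nzf; have /asboolP[P] := af.
elim/poly_ind: P => [|p c IH]; first by rewrite eqxx.
move=> nzP /rootP; rewrite rmorphD rmorphM /= map_polyX map_polyC hornerMXaddC /=.
move=> /eqP; rewrite addr_eq0 => /eqP e.
have [c0|nzc] := eqVneq c 0.
  apply: IH; first by apply: contraNneq nzP => ->; rewrite c0 mul0r add0r.
  by apply/rootP/fps_mulf_eq0/nzf; rewrite e c0 rmorph0 oppr0.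
exists (- (map_poly iota p).[f]).
  by rewrite rpredN fps_alg_horner // => j; rewrite coef_map fps_alg_mpoly.
by exists c => //; rewrite mulNr e opprK.
Qed.

Lemma fps_alg_common_denominator N (q : nat -> fps K n) :
  (forall j, q j \in fps_alg) ->
  exists2 e, e != 0 & forall j, (j < N)%N -> integralOver iota (iota e * q j).
Proof.
move=> aq; elim: N => [|N [e nze inte]]; first by exists 1; rewrite ?oner_eq0.
have /asboolP/fps_algebraic_integral[e' nze' inte'] := aq N.
exists (e * e'); first by rewrite mulf_neq0.
move=> j; rewrite ltnS leq_eqVlt => /orP[/eqP->|lt]; rewrite rmorphM.
  by rewrite -mulrA; apply: integral_mul => //; exact: integral_id.
rewrite mulrAC; apply: integral_mul; [exact: inte | exact: integral_id].
Qed.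

(** Algebraicity is transitive: after clearing denominators the coefficients
    are integral over the polynomials and the leading one is a polynomial [L],
    so that [L * f] is integral. *)
Lemma fps_alg_trans Q f : Q != 0 -> (forall j, Q`_j \in fps_alg) -> root Q f ->
  f \in fps_alg.
Proof.
move=> nzQ aQ /rootP rQ; pose d := (size Q).-1.
have sQ : size Q = d.+1 by rewrite polySpred.
have nzl : Q`_d != 0 by rewrite -lead_coefE lead_coef_eq0.
have [g ag [c nzc ec]] := fps_alg_multiple (aQ d) nzl.
have aq j : g * Q`_j \in fps_alg by rewrite rpredM.
have [e nze inte] := @fps_alg_common_denominator d.+1 _ aq.
pose w j := iota e * (g * Q`_j); pose L := e * c.
have wd : w d = iota L by rewrite /w ec rmorphM.
have ew : \sum_(j < d.+1) w j * f ^+ j = 0.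
  transitivity (iota e * g * Q.[f]); last by rewrite rQ mulr0.
  rewrite horner_coef sQ mulr_sumr; apply: eq_bigr => j _.
  by rewrite /w !mulrA.
have nzL : L != 0 by rewrite mulf_neq0.
suff int : integralOver iota (iota L * f).
  by apply/asboolP/fps_algebraic_integral; exists L.
case ed : d => [|d'].
  have : iota L = 0 by move: ew; rewrite -wd ed big_ord1 expr0 mulr1.
  by rewrite -(rmorph0 iota) => /fps_of_mpoly_inj /eqP; rewrite (negbTE nzL).
pose R : {poly fps K n} := \poly_(j < d) (w j * iota L ^+ (d' - j)).
apply: (@integral_root_monic _ _ _ _ ('X^d + R)).
- by rewrite monicE lead_coefDl ?lead_coefXn // size_polyXn ltnS size_poly.
- apply/rootP; rewrite hornerD hornerXn horner_poly.
  transitivity (iota L ^+ d' * \sum_(j < d.+1) w j * f ^+ j); last first.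
    by rewrite ew mulr0.
  rewrite big_ord_recr /= mulrDr addrC; congr (_ + _).
    rewrite mulr_sumr; apply: eq_bigr => j _.
    have le : (j <= d')%N by rewrite -ltnS -ed.
    rewrite exprMn -{2}(subnK le) exprD; move: (w j) => x.
    by rewrite -!mulrA mulrCA; congr (_ * _); rewrite mulrCA.
  by rewrite wd {1}ed exprMn exprSr -{1}ed mulrA.
apply/integral_poly => j; rewrite coefD coefXn coef_poly.
apply: integral_add; first exact: integral_nat.
case: ifP => lt; last exact: (integral_nat _ 0).
apply: integral_mul; first exact: inte (ltnW lt).
by rewrite -rmorphXn; exact: integral_id.
Qed.

Lemma fps_alg_inverse f g : f \in fps_alg -> f * g = 1 -> g \in fps_alg.
Proof.
move=> af fg; have cE j : (f%:P * 'X - 1)`_j = (if j == 0%N then 0 else (f%:P)`_j.-1) - (j == 0%N)%:R.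
  by rewrite coefB coefMX coef1.
apply: (@fps_alg_trans (f%:P * 'X - 1)).
- apply/eqP=> /(congr1 (fun Q : {poly fps K n} => Q`_1)); rewrite cE coef0 coefC subr0 /= => f0.
  by move: fg; rewrite f0 mul0r => /esym/eqP; rewrite oner_eq0.
- move=> j; rewrite cE rpredB ?rpred_nat //.
  by case: ifP => _; rewrite ?coefC; try case: ifP; rewrite ?rpred0.
by apply/rootP; rewrite !hornerE fg subrr.
Qed.

Lemma fps_alg_sqrt f s : f \in fps_alg -> s ^+ 2 = f -> s \in fps_alg.
Proof.
move=> af e; apply: (@fps_alg_trans ('X^2 - f%:P)).
- by rewrite -size_poly_eq0 size_XnsubC.
- by move=> j; rewrite coefB coefXn coefC rpredB ?rpred_nat //; case: ifP; rewrite ?rpred0.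
by apply/rootP; rewrite hornerD hornerXn hornerN hornerC e subrr.
Qed.

End Algebraic.

(** * Substitution preserves algebraicity *)

Section AlgebraicSubst.
Variable K : fieldType.

Lemma fps_alg_subst_poly m n (phi : psub K m n) P f :
    (forall i, phi i \in fps_alg) -> root (map_poly (@fps_of_mpoly K m) P) f ->
    map_poly (fps_subst phi) (map_poly (@fps_of_mpoly K m) P) != 0 ->
  fps_subst phi f \in fps_alg.
Proof.
move=> aphi rP nz; apply: fps_alg_trans nz _ _ => [j|]; last by rewrite rmorph_root.
by rewrite !coef_map /= fps_subst_of_mpoly; exact: fps_alg_eval.
Qed.

(** The retraction makes the substitution injective, so an equation for [f] is
    mapped to a non-zero polynomial. *)
Lemma fps_alg_subst_retract m n (phi : psub K m n) (sigma : psub K n m) f :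
    (forall i, phi i \in fps_alg) ->
    (forall i, fps_subst sigma (phi i) = fps_X i) ->
  f \in fps_alg -> fps_subst phi f \in fps_alg.
Proof.
move=> aphi retr /asboolP[P nzP rP]; apply: fps_alg_subst_poly rP _ => //.
have inj : injective (fps_subst phi) by apply: can_inj (fps_subst_cancel retr).
apply: contra_neq nzP => e0; apply/polyP=> j; rewrite coef0.
apply: fps_of_mpoly_inj; apply: inj; rewrite !rmorph0.
by have /polyP/(_ j) := e0; rewrite !coef_map coef0.
Qed.

Section Pair.
Variables (m n l : nat).

Fact psub_pair_subproof (phi : psub K m l) (psi : psub K n l) i :
  fps_ord 1 (match split i with inl j => phi j | inr j => psi j end).
Proof. by case: split => j; exact: psub_ord. Qed.

Definition psub_pair (phi : psub K m l) (psi : psub K n l) : psub K (m + n) l :=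
  Psub (psub_pair_subproof phi psi).

Lemma psub_pairl phi psi i : psub_pair phi psi (lshift n i) = phi i.
Proof. by rewrite /= (unsplitK (inl i)). Qed.

Lemma psub_pairr phi psi i : psub_pair phi psi (rshift m i) = psi i.
Proof. by rewrite /= (unsplitK (inr i)). Qed.

End Pair.

Definition psub0 m n : psub K m n := Psub (fun _ => @fps_ord00 K n 1).

Definition psub_lshift m n : psub K m (m + n) :=
  Psub (fun i => fps_ord_X K (lshift n i)).

Definition psub_rshift m n : psub K n (m + n) :=
  Psub (fun i => fps_ord_X K (rshift m i)).

Lemma ord_split_ind m n (P : 'I_(m + n) -> Prop) :
  (forall i, P (lshift n i)) -> (forall i, P (rshift m i)) -> forall i, P i.
Proof. by move=> Pl Pr i; rewrite -(splitK i); case: split => j /=. Qed.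

Lemma mpoly_divX n (i : 'I_n) (p : {mpoly K[n]}) :
  (forall m, m \in msupp p -> m i != 0%N) -> exists q, p = 'X_i * q.
Proof.
move=> nz; exists (\sum_(m <- msupp p) p@_m *: 'X_[m - U_(i)]).
rewrite mulr_sumr {1}[p]mpolyE big_seq [RHS]big_seq; apply: eq_bigr => m mp.
rewrite -scalerAr -mpolyXD addmC submK //.
by apply/mnm_lepP=> j; rewrite mnm1E; case: eqP => // <-; rewrite lt0n nz.
Qed.

Definition psub_drop m n : psub K (m + n) n := psub_pair (psub0 m n) (psub_id K n).

(** Only the second summand of [fps_kill1] remains, so every monomial contains
    the variable. *)
Lemma fps_drop1_eq0 n (p : {mpoly K[1 + n]}) :
  fps_subst (psub_drop 1 n) (fps_of_mpoly p) = 0 ->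
  exists q, p = 'X_(lshift n ord0) * q.
Proof.
set i0 := lshift n ord0; move=> e0; apply: mpoly_divX => m.
have := fps_kill1 i0 (fps_of_mpoly p).
rewrite -(@fps_subst_comp _ _ _ _ (psub_drop 1 n) (psub_rshift 1 n)); last first.
  elim/ord_split_ind => i.
    by rewrite psub_pairl rmorph0 /= (ord1 i) eqxx.
  by rewrite psub_pairr fps_substX.
rewrite e0 rmorph0 add0r mcoeff_msupp => /(congr1 (fun f => fps_coef f m)).
by rewrite fps_coefXM /= => ->; case: ifP => [_ /eqP|/negbT].
Qed.

(** Divide an equation for [f] by the variable as often as possible, then set
    the variable to zero in it. *)
Lemma fps_alg_drop1 n f : f \in fps_alg -> fps_subst (psub_drop 1 n) f \in fps_alg.
Proof.
move=> /asboolP[P nzP rP]; pose i0 : 'I_(1 + n) := lshift n ord0.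
have adrop i : psub_drop 1 n i \in fps_alg.
  move: i; apply: ord_split_ind => i; first by rewrite psub_pairl rpred0.
  by rewrite psub_pairr fps_algX.
have := leqnn (msize (lead_coef P)); move: {2}(msize _) => N.
elim: N P nzP rP => [|N IH] P nzP rP.
  by rewrite leqn0 msize_poly_eq0 lead_coef_eq0 (negbTE nzP).
move=> leN; have [e0|] := eqVneq (map_poly (fps_subst (psub_drop 1 n))
  (map_poly (@fps_of_mpoly K _) P)) 0; last exact: fps_alg_subst_poly rP.
have /choice[q eq] j : exists q, P`_j = 'X_i0 * q.
  apply: fps_drop1_eq0; have /polyP/(_ j) := e0.
  by rewrite !coef_map coef0.
pose P' := \poly_(j < size P) q j.
have eP : P = 'X_i0 *: P'.
  apply/polyP=> j; rewrite coefZ coef_poly; case: ltnP => [_|le]; first exact: eq.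
  by rewrite mulr0 nth_default.
have nzX : 'X_i0 != 0 :> {mpoly K[1 + n]} by rewrite -msize_poly_eq0 msizeX.
have nzP' : P' != 0 by apply: contraNneq nzP => e; rewrite eP e scaler0.
apply: (IH P') => //.
  apply/rootP; apply: (@fps_X_cancel _ _ i0); move/rootP: rP; rewrite {1}eP.
  by rewrite -mul_polyC rmorphM /= map_polyC hornerM hornerC.
move: leN; rewrite eP lead_coefZ msizeM ?lead_coef_eq0 //.
by rewrite msizeX mdeg1.
Qed.

Lemma fps_alg_drop m n f : f \in fps_alg -> fps_subst (psub_drop m n) f \in fps_alg.
Proof.
elim: m f => [|m IH] f af.
  rewrite (_ : fps_subst _ f = f) //; apply: fps_subst_eqid.
  by apply: ord_split_ind => i; [case: i | rewrite psub_pairr; congr fps_X; apply: val_inj].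
rewrite -(@fps_subst_comp _ _ _ _ (psub_drop 1 (m + n)) (psub_drop m n)).
  by apply: IH; apply: fps_alg_drop1.
have dropl (j : 'I_(m + n)) i : val i = j.+1 -> psub_drop 1 (m + n) i = fps_X j.
  move=> e; transitivity (psub_drop 1 (m + n) (rshift 1 j)).
    by congr (psub_val _ _); apply: val_inj; rewrite e.
  exact: psub_pairr.
have drop0 i : val i = 0%N -> psub_drop 1 (m + n) i = 0.
  move=> e; transitivity (psub_drop 1 (m + n) (lshift _ (ord0 : 'I_1))).
    by congr (psub_val _ _); apply: val_inj; rewrite e.
  exact: psub_pairl.
apply: (@ord_split_ind m.+1 n) => i; rewrite ?psub_pairl ?psub_pairr.
  case: (unliftP ord0 i) => [j ->|->]; last by rewrite drop0 ?rmorph0.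
  by rewrite (dropl (lshift n j)) // fps_substX psub_pairl.
by rewrite (dropl (rshift m i)) // fps_substX psub_pairr.
Qed.

(** A series in [y] evaluated at [phi x] is the value at [y = 0] of its
    translate [f (y + phi x)], and the translation has a left inverse, namely
    [x = 0]. *)
Theorem fps_alg_subst m n (phi : psub K m n) f : (forall i, phi i \in fps_alg) ->
  f \in fps_alg -> fps_subst phi f \in fps_alg.
Proof.
move=> aphi af.
have o i : fps_ord 1 (psub_lshift m n i + fps_subst (psub_rshift m n) (phi i)).
  by apply: fps_ordD; [exact: psub_ord | apply: fps_ord_subst; exact: psub_ord].
pose tau : psub K m (m + n) := Psub o.
rewrite -(@fps_subst_comp _ _ _ _ tau (psub_drop m n)) => [|i]; last first.
  rewrite rmorphD /= fps_substX psub_pairl add0r.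
  by apply: fps_subst_cancel => j; rewrite fps_substX psub_pairr.
apply: fps_alg_drop; pose sigma := psub_pair (psub_id K m) (psub0 n m).
apply: (@fps_alg_subst_retract _ _ _ sigma) => // i /=.
  rewrite rpredD ?fps_algX //.
  apply: (@fps_alg_subst_retract _ _ _ (psub_drop m n)) => // j.
    exact: fps_algX.
  by rewrite fps_substX psub_pairr.
rewrite rmorphD /= fps_substX psub_pairl.
rewrite (fps_subst_comp (chi := psub0 n m)); last first.
  by move=> j; rewrite fps_substX psub_pairr.
by rewrite fps_subst0 // (fps_ord1P _).1 ?scale0r ?addr0 //; exact: psub_ord.
Qed.

End AlgebraicSubst.

(** * Inverse function theorem *)

Section AlgebraicInverse.
Variable K : fieldType.

Lemma mpoly_rmorph_eq n (R : comNzRingType) (u v : {rmorphism {mpoly K[n]} -> R}) :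
  (forall c, u c%:MP = v c%:MP) -> (forall i, u 'X_i = v 'X_i) -> u =1 v.
Proof.
move=> eC eX p; rewrite [p]mpolyE !rmorph_sum; apply: eq_bigr => a _ /=.
rewrite -mul_mpolyC !rmorphM eC mpolyXE_id !rmorph_prod /=; congr (_ * _).
by apply: eq_bigr => i _; rewrite !rmorphXn /= eX.
Qed.

(** An equation P(x, t) = 0 is to be read as an equation for x_i with t among the
    coordinates. For this the variable [i] of the coefficients is exchanged with
    the variable of the polynomial; the exchange is an involution, so it keeps
    equations non-zero. *)
Section Swap.
Variables (n : nat) (i : 'I_n).
Local Notation PP := {poly {mpoly K[n]}}.

Definition swap_coef : {mpoly K[n]} -> PP :=
  mmap (polyC \o @mpolyC n K) (fun j => if j == i then 'X else ('X_j)%:P).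

HB.instance Definition _ := GRing.RMorphism.copy swap_coef
  (mmap (polyC \o @mpolyC n K) (fun j => if j == i then 'X else ('X_j)%:P)).

Definition swap (P : PP) : PP := (map_poly swap_coef P).[('X_i)%:P].

HB.instance Definition _ := GRing.RMorphism.copy swap
  (horner_eval (('X_i)%:P : PP) \o map_poly swap_coef).

Lemma swapC p : swap p%:P = swap_coef p.
Proof. by rewrite /swap map_polyC hornerC. Qed.

Lemma swap_coefX j : swap_coef 'X_j = if j == i then 'X else ('X_j)%:P.
Proof. by rewrite /swap_coef mmapX mmap1U. Qed.

Lemma swap_coefC c : swap_coef c%:MP = (c%:MP)%:P.
Proof. by rewrite /swap_coef mmapC. Qed.

Lemma swapX : swap 'X = ('X_i)%:P.
Proof. by rewrite /swap map_polyX hornerX. Qed.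

Lemma swapK : involutive swap.
Proof.
have e : swap \o swap_coef =1 polyC.
  apply: mpoly_rmorph_eq => [c|j] /=; first by rewrite swap_coefC swapC swap_coefC.
  rewrite swap_coefX; case: eqP => [->|/eqP ne]; first by rewrite swapX.
  by rewrite swapC swap_coefX (negbTE ne).
move=> P; rewrite -[P]coefK poly_def !rmorph_sum; apply: eq_bigr => l _ /=.
rewrite -mul_polyC !rmorphM !rmorphXn /= swapC swapX swapC swap_coefX eqxx.
by rewrite -[swap _]/((swap \o swap_coef) _) e.
Qed.

(** Both sides evaluate [P] with [psi i] in place of x_i and x_i in place of t. *)
Lemma swap_subst (psi : psub K n n) (P : PP) :
    (forall j, j != i -> psi j = fps_X j) ->
  (map_poly (@fps_of_mpoly K n) (swap P)).[psi i] =
  (map_poly (fps_subst psi) (map_poly (@fps_of_mpoly K n) P)).[fps_X i].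
Proof.
move=> psiX; pose V : {rmorphism PP -> fps K n} :=
  horner_eval (psi i) \o map_poly (@fps_of_mpoly K n).
have eV : V \o swap_coef =1 fps_subst psi \o @fps_of_mpoly K n.
  apply: mpoly_rmorph_eq => [c|j] /=.
    rewrite swap_coefC map_polyC /horner_eval hornerC /= -[c%:MP]mulr1 mul_mpolyC.
    by rewrite fps_of_mpolyZ linearZ /= !rmorph1.
  rewrite swap_coefX fps_substX; case: eqP => [->|/eqP ne].
    by rewrite map_polyX /horner_eval hornerX.
  by rewrite map_polyC /horner_eval hornerC psiX.
rewrite -[LHS]/(V (swap P)) -[P]coefK poly_def !rmorph_sum horner_sum.
apply: eq_bigr => l _ /=.
rewrite -mul_polyC !rmorphM !rmorphXn /= map_polyC map_polyX map_polyC map_polyX.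
rewrite hornerM hornerC hornerXn swapC swapX; congr (_ * _ ^+ _); first exact: eV.
by rewrite map_polyC /horner_eval hornerC.
Qed.

End Swap.

(** Reading the equation of [phi i] in the new coordinates gives an equation
    for the coordinate [i] of the inverse. *)
Lemma fps_alg_inverse_coord n (phi : psub K n n) i : jac phi = 1%:M ->
    (forall j, j != i -> phi j = fps_X j) -> phi i \in fps_alg ->
  exists psi : psub K n n, [/\ forall j, j != i -> psi j = fps_X j,
    jac psi = 1%:M, forall j, psi j \in fps_alg
    & forall j, fps_subst psi (phi j) = fps_X j].
Proof.
move=> jac1 phiX /asboolP[P nzP rP].
have [psi [psiX jpsi inv]] := fps_inverse_coord jac1 phiX.
exists psi; split=> // j; have [->|ne] := eqVneq j i; last by rewrite psiX ?fps_algX.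
apply/asboolP; exists (swap i P); first by rewrite -(rmorph0 (swap i)) (can_eq (swapK i)).
apply/rootP; rewrite swap_subst // -inv; apply/rootP.
by rewrite rmorph_root.
Qed.

Definition psub_mx_subproof m n (M : 'M[K]_(m, n)) i :
  fps_ord 1 (\sum_j M i j *: fps_X j).
Proof. by apply: fps_ord_sum => j _; apply/fps_ordZ/fps_ord_X. Qed.

Definition psub_mx m n (M : 'M[K]_(m, n)) : psub K m n := Psub (psub_mx_subproof M).

Lemma jac_mx m n (M : 'M[K]_(m, n)) : jac (psub_mx M) = M.
Proof.
apply/matrixP=> i j; rewrite mxE /= fps_coef_sum (bigD1 j) //.
rewrite fps_coefZ fps_coefXU eqxx mulr1 big1 => [|l ne]; first exact: addr0.
by rewrite fps_coefZ fps_coefXU (negbTE ne) mulr0.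
Qed.

Lemma fps_alg_mx m n (M : 'M[K]_(m, n)) i : psub_mx M i \in fps_alg.
Proof. by rewrite /= rpred_sum // => j _; rewrite rpredZ ?fps_algX. Qed.

Definition psub_comp l m n (phi : psub K l m) (psi : psub K m n) : psub K l n :=
  Psub (fun i => fps_ord_subst psi (psub_ord phi i)).

Lemma psub_compE l m n (phi : psub K l m) (psi : psub K m n) f :
  fps_subst (psub_comp phi psi) f = fps_subst psi (fps_subst phi f).
Proof. by apply/esym/fps_subst_comp. Qed.

Lemma jac_compE l m n (phi : psub K l m) (psi : psub K m n) :
  jac (psub_comp phi psi) = jac phi *m jac psi.
Proof. exact: jac_comp. Qed.

Lemma fps_alg_comp l m n (phi : psub K l m) (psi : psub K m n) :
  (forall i, phi i \in fps_alg) -> (forall i, psi i \in fps_alg) ->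
  forall i, psub_comp phi psi i \in fps_alg.
Proof. by move=> aphi apsi i; apply: fps_alg_subst. Qed.

(** By induction on the number of coordinates that are not variables: composing
    with the inverse of a change of one such coordinate turns it into a
    variable and leaves those that already are variables alone. *)
Lemma fps_alg_inverse_tangent n (phi : psub K n n) : jac phi = 1%:M ->
    (forall i, phi i \in fps_alg) ->
  exists2 psi : psub K n n, forall i, psi i \in fps_alg
    & forall i, fps_subst psi (phi i) = fps_X i.
Proof.
have := leqnn #|[set i | phi i != fps_X i]|; move: {2}#|_| => N.
elim: N phi => [|N IH] phi leN jac1 aphi.
  exists (psub_id K n) => [i|i]; first exact: fps_algX.
  rewrite fps_subst_id; apply/eqP; move: leN; rewrite leqn0 cards_eq0.
  by move=> /eqP/setP/(_ i); rewrite !inE => /negbFE.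
have [/eqP e0|[i]] := set_0Vmem [set i | phi i != fps_X i].
  by apply: IH => //; rewrite (eqP e0) cards0.
rewrite inE => nei.
pose alpha := psub_upd (psub_id K n) i (psub_ord phi i).
have alphaX j : j != i -> alpha j = fps_X j by move=> /negbTE /= ->.
have alphai : alpha i = phi i by rewrite /= eqxx.
have jalpha : jac alpha = 1%:M.
  apply/matrixP=> j l; rewrite !mxE; have [->|ne] := eqVneq j i.
    by rewrite alphai; move/matrixP/(_ i l): jac1; rewrite !mxE.
  by rewrite alphaX // fps_coefXU.
have [|psi [psiX jpsi apsi inv]] := fps_alg_inverse_coord jalpha alphaX.
  by rewrite alphai.
have [||chi achi invchi] := IH (psub_comp phi psi) _ _ (fps_alg_comp aphi apsi).
- rewrite -ltnS; apply: leq_trans leN; apply: proper_card; apply/properP; split.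
    apply/subsetP=> j; rewrite !inE /=; apply: contraNneq => e.
    have ne : j != i by apply: contraNneq nei => <-; rewrite e.
    by rewrite e fps_substX psiX.
  by exists i; rewrite inE // negbK /= -alphai inv.
- by rewrite jac_compE jac1 jpsi mulmx1.
exists (psub_comp psi chi) => [|j]; first exact: fps_alg_comp.
by rewrite psub_compE invchi.
Qed.

(** A linear change reduces to maps tangent to the identity. *)
Lemma fps_alg_left_inverse n (phi : psub K n n) : jac phi \in unitmx ->
    (forall i, phi i \in fps_alg) ->
  exists2 psi : psub K n n, forall i, psi i \in fps_alg
    & forall i, fps_subst psi (phi i) = fps_X i.
Proof.
move=> ujac aphi; pose lambda := psub_mx (invmx (jac phi)).
have alambda := fps_alg_mx (invmx (jac phi)).
have [||psi apsi inv] := @fps_alg_inverse_tangent n (psub_comp phi lambda).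
- by rewrite jac_compE jac_mx mulmxV.
- exact: fps_alg_comp.
exists (psub_comp lambda psi) => [|i]; first exact: fps_alg_comp.
by rewrite psub_compE inv.
Qed.

Theorem fps_alg_inverse_function n (phi : psub K n n) : jac phi \in unitmx ->
    (forall i, phi i \in fps_alg) ->
  exists psi : psub K n n, [/\ forall i, psi i \in fps_alg, jac psi \in unitmx,
    cancel (fps_subst phi) (fps_subst psi) & cancel (fps_subst psi) (fps_subst phi)].
Proof.
move=> ujac aphi; have [psi apsi inv] := fps_alg_left_inverse ujac aphi.
have [_ upsi] : jac phi \in unitmx /\ jac psi \in unitmx.
  by apply: mulmx1_unit; rewrite -(jac_comp (chi := psub_id K n)) ?jac_id.
have [chi _ invpsi] := fps_alg_left_inverse upsi apsi.
have canphi := fps_subst_cancel inv; have canpsi := fps_subst_cancel invpsi.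
by exists psi; split=> // f; apply: (can_inj canpsi); rewrite canphi.
Qed.

End AlgebraicInverse.

(** * The ring of algebraic series *)

Section AlgpsRing.
Variable K : fieldType.

Lemma fps_alg_kill n S (f : fps K n) : f \in fps_alg ->
  fps_subst (kill K S) f \in fps_alg.
Proof.
apply: fps_alg_subst => i /=.
by case: ifP => _; [exact: rpred0 | exact: fps_algX].
Qed.

Lemma fps_alg_divX n S (i : 'I_n) (f : fps K n) : f \in fps_alg ->
  fps_divX S i f \in fps_alg.
Proof.
move=> af; rewrite /fps_divX; set g := fps_subst _ f.
have ag : g \in fps_alg by exact: fps_alg_kill.
apply: (@fps_alg_mulIl _ _ 'X_i); first by rewrite -msize_poly_eq0 msizeX.
rewrite -[_ * _](addKr (fps_subst (kill K (pred1 i)) g)) -fps_kill1 addrC.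
by rewrite rpredB // fps_alg_kill.
Qed.

Section OneRing.
Variable n : nat.
Implicit Types (f g : algps K n).
Local Notation maxI := (@max_ideal K n).

Lemma algps_valP f : (f : fps K n) \in fps_alg.
Proof. exact: (valP f). Qed.

Lemma algps_val_inj : injective (@algps_val K n).
Proof. exact: val_inj. Qed.

Lemma algps_val_sum I (r : seq I) (P : pred I) (F : I -> algps K n) :
  algps_val (\sum_(i <- r | P i) F i) = \sum_(i <- r | P i) algps_val (F i).
Proof. exact: (rmorph_sum (val : algps K n -> fps K n)). Qed.

Lemma algps_ord1_divXP f : fps_ord 1 f ->
  f = \sum_i AlgPs (fps_alg_divX predT i (algps_valP f)) * algps_X K i.
Proof.
move=> o; apply: algps_val_inj; rewrite algps_val_sum /= {1}(fps_ord1_divXP o).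
by apply: eq_bigr => i _; rewrite mulrC.
Qed.

Lemma max_idealP f : maxI f <-> fps_ord 1 f.
Proof.
split=> [[h ->]|/algps_ord1_divXP e]; last by eexists; exact: e.
rewrite algps_val_sum; apply: fps_ord_sum => i _; apply: fps_ordMr.
exact: fps_ord_X.
Qed.

(** The division by variables stays inside the algebraic series, so membership in
    a power of the maximal ideal can be tested on coefficients. *)
Lemma idealX_ordP d f : idealX maxI d f <-> fps_ord d f.
Proof.
elim: d f => [|d IH] f //=; split=> [[N [a [b [ab ->]]]]|o].
  rewrite algps_val_sum; apply: fps_ord_sum => i _; rewrite -add1n.
  by have [/max_idealP oa /IH ob] := ab i; apply: fps_ordM.
exists n, (fun i => algps_X K i), (fun i => AlgPs (fps_alg_divX predT i (algps_valP f))).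
split=> [i|].
  by split; [apply/max_idealP; exact: fps_ord_X | apply/IH; exact: fps_ord_divX].
rewrite {1}(algps_ord1_divXP (fps_ordW (ltn0Sn d) o)).
by apply: eq_bigr => i _; rewrite mulrC.
Qed.

End OneRing.

Section AlgpsSubst.
Variables (m n : nat) (phi : psub K m n) (aphi : forall i, phi i \in fps_alg).

Definition algps_subst (f : algps K m) : algps K n :=
  AlgPs (fps_alg_subst aphi (algps_valP f)).

Fact algps_subst_zmod : zmod_morphism algps_subst.
Proof. by move=> f g; apply: algps_val_inj; rewrite /= rmorphB. Qed.
HB.instance Definition _ := GRing.isZmodMorphism.Build
  (algps K m) (algps K n) algps_subst algps_subst_zmod.

Fact algps_subst_monoid : monoid_morphism algps_subst.
Proof.
by split=> [|f g]; apply: algps_val_inj; rewrite /= ?rmorph1 ?rmorphM.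
Qed.
HB.instance Definition _ := GRing.isMonoidMorphism.Build
  (algps K m) (algps K n) algps_subst algps_subst_monoid.

Fact algps_subst_scalable : scalable algps_subst.
Proof. by move=> c f; apply: algps_val_inj; rewrite /= linearZ. Qed.
HB.instance Definition _ := GRing.isScalable.Build
  K (algps K m) (algps K n) *:%R algps_subst algps_subst_scalable.

End AlgpsSubst.

Lemma algps_inverse n (f : algps K n) : fps_coef f 0%MM != 0 ->
  exists g, f * g = 1.
Proof.
move=> /fps_inverse[g fg].
exists (AlgPs (fps_alg_inverse (algps_valP f) fg)).
exact: algps_val_inj.
Qed.

(** An algebra morphism is local because a variable minus a non-zero constant is
    a unit; hence it is the substitution of the images of the variables, as
    follows by repeatedly dividing by the variables. *)
Lemma algps_morph_subst m n (theta : {lrmorphism algps K m -> algps K n}) :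
  exists2 phi : psub K m n, forall i, phi i \in fps_alg
    & forall f, theta f = fps_subst phi f :> fps K n.
Proof.
have o i : fps_ord 1 (theta (algps_X K i)).
  apply/fps_ord1P; set c := fps_coef _ _; apply/eqP; apply: contraT => nzc.
  have [|g eg] := @algps_inverse _ (algps_X K i - c%:A).
    rewrite fps_coefB fps_coefZ fps_coef1 eqxx mulr1.
    by rewrite ((fps_ord1P _).1 (@fps_ord_X K m i)) sub0r oppr_eq0.
  have et : (theta (algps_X K i) - c%:A) * theta g = 1.
    transitivity (theta ((algps_X K i - c%:A) * g)); last by rewrite eg rmorph1.
    by rewrite rmorphM rmorphB /= rmorph_alg.
  have := congr1 (fun h : algps K n => fps_coef h 0%MM) et.
  set t := theta (algps_X K i).
  rewrite -[algps_val _]/((algps_val t - c%:A) * algps_val (theta g)).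
  rewrite fps_coefM0 fps_coefB -/c fps_coefZ !fps_coef1 eqxx mulr1 subrr mul0r.
  by move/eqP; rewrite eq_sym oner_eq0.
exists (Psub o) => [i|f]; first exact: algps_valP.
apply: fps_ord_eq => d; elim: d f => [|d IH] f //.
pose c := fps_coef f 0%MM; have oc : fps_ord 1 (f - c%:A) by exact: fps_ord_subC.
rewrite -(subrK c%:A f) (algps_ord1_divXP oc) !rmorphD /= !rmorph_alg.
rewrite opprD addrACA subrr addr0 !rmorph_sum algps_val_sum /=.
rewrite algps_val_sum rmorph_sum -sumrB; apply: fps_ord_sum => i _.
set h := AlgPs _; rewrite !rmorphM /= fps_substX /= -mulrBl mulrC -add1n.
by apply: fps_ordM.
Qed.

(** The Jacobian matrix of an automorphism is invertible because preimages of the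
    variables give a right inverse of the substitution; the converse is the
    inverse function theorem. *)
Lemma right_equivP n (f g : algps K n) : right_equiv f g <->
  exists phi : psub K n n, [/\ forall i, phi i \in fps_alg,
    jac phi \in unitmx & fps_subst phi f = g].
Proof.
split=> [[theta [theta' thK thK'] ef]|[phi [aphi ujac ef]]].
  have [phi aphi ephi] := algps_morph_subst theta; exists phi; split=> //; last first.
    by rewrite -ephi ef.
  have inv i : fps_subst phi (theta' (algps_X K i)) = fps_X i by rewrite -ephi thK'.
  have o i : fps_ord 1 (theta' (algps_X K i)).
    by apply/fps_ord1P; rewrite -(fps_subst_coef0 phi) inv; apply/fps_ord1P/fps_ord_X.
  have [] // := @mulmx1_unit _ _ (jac (Psub o)) (jac phi).
  by rewrite -(jac_comp (chi := psub_id K n)) ?jac_id.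
have [psi [apsi _ can1 can2]] := fps_alg_inverse_function ujac aphi.
exists (algps_subst aphi); last exact: algps_val_inj.
by exists (algps_subst apsi) => h; apply: algps_val_inj; rewrite /= ?can1 ?can2.
Qed.

Lemma right_equiv_sym n (f g : algps K n) : right_equiv f g -> right_equiv g f.
Proof.
move=> /right_equivP[phi [aphi ujac e]]; apply/right_equivP.
have [psi [apsi upsi can1 can2]] := fps_alg_inverse_function ujac aphi.
by exists psi; split=> //; rewrite -e can1.
Qed.

Lemma right_equiv_trans n (g f h : algps K n) :
  right_equiv f g -> right_equiv g h -> right_equiv f h.
Proof.
move=> /right_equivP[phi [aphi ujac e]] /right_equivP[psi [apsi upsi e']].
apply/right_equivP; exists (psub_comp phi psi); split.
- exact: fps_alg_comp.
- by rewrite jac_compE unitmx_mul ujac.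
by rewrite psub_compE e.
Qed.

End AlgpsRing.

(** * Hessian matrices *)

Lemma sumr_delta (V : nmodType) (I : finType) (F : I -> V) p :
  \sum_i F i *+ (p == i) = F p.
Proof.
rewrite (bigD1 p) //= eqxx big1 ?addr0 // => i ne.
by rewrite eq_sym (negbTE ne).
Qed.

Section Hessian.
Variable K : fieldType.

Section OneRing.
Variable n : nat.
Implicit Types (f g h : fps K n) (i j p q : 'I_n).

Lemma hessianE f i j :
  hessian f i j = fps_coef f (U_(i) + U_(j))%MM *+ (i == j).+1.
Proof. by rewrite mxE /= !mnmDE !mnm0E mnm1E add0n add0m mulr1n. Qed.

Lemma hessian_zmod : zmod_morphism (@hessian K n).
Proof. by move=> f g; apply/matrixP=> i j; rewrite !mxE /= !mulrnBl. Qed.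
HB.instance Definition _ := GRing.isZmodMorphism.Build
  (fps K n) 'M[K]_n (@hessian K n) hessian_zmod.

Lemma hessianD f g i j : hessian (f + g) i j = hessian f i j + hessian g i j.
Proof. by rewrite !hessianE fps_coefD mulrnDl. Qed.

Lemma hessian_sum I (r : seq I) (P : pred I) (F : I -> fps K n) i j :
  hessian (\sum_(l <- r | P l) F l) i j = \sum_(l <- r | P l) hessian (F l) i j.
Proof. by rewrite raddf_sum summxE. Qed.

Lemma hessian_sym f : (hessian f)^T = hessian f.
Proof. by apply/matrixP=> i j; rewrite mxE !hessianE addmC eq_sym. Qed.

Lemma hessian_ord3 f : fps_ord 3 f -> hessian f = 0.
Proof.
move=> o; apply/matrixP=> i j; rewrite hessianE o ?mul0rn ?mxE //.
by rewrite mdegD !mdeg1.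
Qed.

(** The diagonal entries of the Hessian are twice the coefficients of the
    squares. *)
Lemma fps_ord3P f : (2%:R : K) != 0 -> fps_ord 2 f ->
  (hessian f = 0 <-> fps_ord 3 f).
Proof.
move=> nz2 o; split=> [h0 a|]; last exact: hessian_ord3.
rewrite ltnS leq_eqVlt => /orP[/eqP a2|]; last exact: o.
have [i ai] : exists i, a i != 0%N.
  apply/existsP; apply: contraT => /existsPn a0; move: a2.
  by rewrite mdegE big1 // => i _; apply/eqP; rewrite -[_ == _]negbK.
have sub : (U_(i) <= a)%MM.
  by apply/mnm_lepP=> l; rewrite mnm1E; case: eqP => // <-; rewrite lt0n.
have /mdeg1P[j /eqP ej] : mdeg (a - U_(i))%MM == 1%N.
  by rewrite -(eqn_add2r (mdeg U_(i)%MM)) -mdegD submK // a2 mdeg1.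
move/matrixP/(_ i j)/eqP: h0; rewrite hessianE mxE -ej addmC submK //.
case: (i == j); last by rewrite mulr1n => /eqP.
by rewrite -mulr_natr mulf_eq0 (negbTE nz2) orbF => /eqP.
Qed.

Lemma hessian_mulX i h p q : hessian (fps_X i * h) p q =
  fps_coef h U_(q)%MM *+ (p == i) + fps_coef h U_(p)%MM *+ (q == i).
Proof.
rewrite hessianE fps_coefXM mnmDE !mnm1E.
have [->|np] := eqVneq p i.
  rewrite (eq_sym i q) addmC addmK.
  by have [->|_] := eqVneq q i; rewrite ?addr0.
have [->|nq] := eqVneq q i; last by rewrite addr0 mul0rn.
by rewrite addmK (negbTE np) add0r.
Qed.

Lemma fps_coef_mulU f g p : fps_ord 1 g ->
  fps_coef (f * g) U_(p)%MM = fps_coef f 0%MM * fps_coef g U_(p)%MM.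
Proof.
move=> o; rewrite -[in LHS](subrK (fps_coef f 0%MM)%:A f) mulrDl fps_coefD.
rewrite (fps_ordM (fps_ord_subC f) o) ?mdeg1 // add0r.
by rewrite -scalerAl mul1r fps_coefZ.
Qed.

Lemma hessian_mul g h p q : fps_ord 1 g -> fps_ord 1 h ->
  hessian (g * h) p q = fps_coef g U_(p)%MM * fps_coef h U_(q)%MM
                      + fps_coef g U_(q)%MM * fps_coef h U_(p)%MM.
Proof.
move=> og oh; pose d i := fps_divX predT i g.
have ed i : fps_coef g U_(i)%MM = fps_coef (d i) 0%MM.
  rewrite {1}(fps_ord1_divXP og) fps_coef_sum (bigD1 i) // big1 => [|j ne].
    by rewrite fps_coefXM mnm1E eqxx -[X in (X - _)%MM]add0m addmK; exact: addr0.
  by rewrite fps_coefXM mnm1E (eq_sym i) (negbTE (ne : j != i)).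
rewrite !ed {1}(fps_ord1_divXP og) mulr_suml hessian_sum.
under eq_bigr => i _ do rewrite -mulrA hessian_mulX !fps_coef_mulU //.
by rewrite big_split /= !sumr_delta.
Qed.

End OneRing.

(** As [f] has no linear part, only the linear part of [phi] contributes to the
    terms of degree 2. *)
Lemma hessian_subst m n (phi : psub K m n) f : fps_ord 2 f ->
  hessian (fps_subst phi f) = (jac phi)^T *m hessian f *m jac phi.
Proof.
move=> o2; have o1 : fps_ord 1 f by exact: fps_ordW o2.
pose h i := fps_divX predT i f.
have oh i : fps_ord 1 (h i) by apply: fps_ord_divX.
have eH i j : hessian f i j = fps_coef (h i) U_(j)%MM + fps_coef (h j) U_(i)%MM.
  rewrite {1}(fps_ord1_divXP o1) hessian_sum.
  under eq_bigr => l _ do rewrite hessian_mulX.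
  by rewrite big_split /= !sumr_delta.
apply/matrixP=> p q; rewrite {1}(fps_ord1_divXP o1) rmorph_sum hessian_sum /= mxE.
have -> : \sum_i (((jac phi)^T *m hessian f) p i * jac phi i q) =
  \sum_i \sum_j (jac phi j p * fps_coef (h j) U_(i)%MM * jac phi i q +
                jac phi i q * fps_coef (h i) U_(j)%MM * jac phi j p).
  apply: eq_bigr => i _; rewrite mxE mulr_suml; apply: eq_bigr => j _.
  rewrite mxE eH mulrDr mulrDl; congr (_ + _).
  by rewrite mulrC (mulrC (jac phi j p)) mulrA.
have -> : \sum_i hessian (fps_subst phi (fps_X i * h i)) p q =
  \sum_i \sum_j (jac phi i p * fps_coef (h i) U_(j)%MM * jac phi j q +
                jac phi i q * fps_coef (h i) U_(j)%MM * jac phi j p).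
  apply: eq_bigr => i _; rewrite rmorphM /= fps_substX hessian_mul; last 2 first.
  - exact: psub_ord.
  - by apply: fps_ord_subst.
  rewrite !fps_linear_subst // !mulr_sumr -big_split; apply: eq_bigr => j _.
  by rewrite !mxE !mulrA.
under eq_bigr do rewrite big_split; rewrite big_split /= exchange_big /=.
by under [in RHS]eq_bigr do rewrite big_split; rewrite [in RHS]big_split.
Qed.

End Hessian.

(** * Symmetric matrices *)

Lemma ulsubmx_scalar (R : nzRingType) n (A : 'M[R]_(1 + n)) :
  ulsubmx A = (A 0 0)%:M.
Proof.
by rewrite [LHS]mx11_scalar !mxE; congr (A _ _)%:M; apply: val_inj.
Qed.

(** Completing the square in the first variable. *)
Lemma complete_square (R : comNzRingType) n (c u : R) (b : 'rV[R]_n) (C : 'M[R]_n) :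
    c * u = 1 ->
  let F : 'M[R]_(1 + n) := block_mx 1%:M (u *: b) 0 1%:M in
  block_mx c%:M b b^T C =
    F^T *m block_mx c%:M 0 0 (C - u *: (b^T *m b)) *m F.
Proof.
move=> cu F; have -> : F^T = block_mx 1%:M 0 (u *: b^T) 1%:M.
  rewrite /F tr_block_mx !trmx1 trmx0; congr block_mx.
  by apply/matrixP=> i j; rewrite !mxE.
rewrite /F !mulmx_block !(mul1mx, mul0mx, mulmx1, mulmx0, addr0, add0r).
have e1 : u *: b^T *m c%:M = b^T by rewrite mul_mx_scalar scalerA cu scale1r.
congr block_mx; rewrite ?e1 //.
  by rewrite mul_scalar_mx scalerA cu scale1r.
by rewrite -scalemxAr addrC subrK.
Qed.

Section Symmetric.
Variable K : fieldType.
Hypothesis nz2 : (2%:R : K) != 0.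

(** A quadratic form that vanishes everywhere has zero polar form, which is twice
    the bilinear form. *)
Lemma quad_neq0 n (H : 'M[K]_n) : H^T = H -> H != 0 ->
  exists w : 'rV_n, w *m H *m w^T != 0.
Proof.
move=> sym nzH; apply/not_existsP => q0; case/eqP: nzH.
have {}q0 (w : 'rV_n) : w *m H *m w^T = 0 by apply/eqP; have /negP/negPn := q0 w.
apply/matrixP=> i j; rewrite [RHS]mxE.
pose e l : 'rV[K]_n := delta_mx 0 l.
have eB l1 l2 : (e l1 *m H *m (e l2)^T) 0 0 = H l1 l2.
  by rewrite /e trmx_delta -rowE -colE !mxE.
have := q0 (e i + e j); rewrite linearD /= !mulmxDl !mulmxDr !q0 add0r addr0.
move=> /matrixP/(_ 0 0); rewrite [LHS]mxE !eB [RHS]mxE.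
have -> : H j i = H i j by rewrite -[in LHS]sym mxE.
by rewrite -mulr2n -mulr_natr => /eqP; rewrite mulf_eq0 (negbTE nz2) orbF => /eqP.
Qed.

Lemma row_unitmx n (w : 'rV[K]_n.+1) : w != 0 ->
  exists2 P : 'M_n.+1, P \in unitmx & exists c, w = c *: row 0 P.
Proof.
move=> nzw; exists (row_ebase w); first exact: row_ebase_unit.
exists (col_ebase w 0 0).
have rk : \rank w = 1%N by rewrite rank_rV nzw.
rewrite -{1}(mulmx_ebase w) rk rowE [col_ebase w in LHS]mx11_scalar mul_scalar_mx -scalemxAl.
congr (_ *: (_ *m _)); apply/matrixP=> i j; rewrite !mxE (ord1 i).
by rewrite eqxx andbT andTb eq_sym.
Qed.

Lemma mxrank_congr n (P M : 'M[K]_n) : P \in unitmx ->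
  \rank (P^T *m M *m P) = \rank M.
Proof.
move=> uP; rewrite mxrankMfree ?row_free_unit // -mxrank_tr trmx_mul trmxK.
by rewrite mxrankMfree ?row_free_unit // mxrank_tr.
Qed.

(** A vector on which the form does not vanish is completed to a basis and the
    square is completed in its direction; the recursion ends with a zero form,
    so the non-zero diagonal entries come first. *)
Lemma sym_diagonalize n (H : 'M[K]_n) : H^T = H ->
  exists2 P : 'M_n, P \in unitmx & exists2 d : 'rV_n,
    H = P^T *m diag_mx d *m P & forall i : 'I_n, (d 0 i != 0) = (i < \rank H)%N.
Proof.
elim: n H => [|n IH] H sym.
  exists 1%:M; first exact: unitmx1.
  by exists 0 => [|[]//]; apply/matrixP => -[].
have [->|nzH] := eqVneq H 0.
  exists 1%:M; first exact: unitmx1.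
  exists 0 => [|i]; first by rewrite raddf0 mulmx0 mul0mx.
  by rewrite mxE eqxx mxrank0.
have [w nzq] := quad_neq0 sym nzH.
have nzw : w != 0 by apply: contraNneq nzq => ->; rewrite !mul0mx.
have [P0 uP0 [a ew]] := row_unitmx nzw.
pose H1 : 'M[K]_(1 + n) := P0 *m H *m P0^T.
have symH1 : H1^T = H1 by rewrite /H1 !trmx_mul trmxK sym mulmxA.
pose c := H1 0 0; pose b := ursubmx H1; pose C := drsubmx H1.
have nzc : c != 0.
  apply: contraNneq nzq => c0; suff: row 0 P0 *m H *m (row 0 P0)^T = 0.
    by rewrite ew linearZ /= -!scalemxAl -scalemxAr => ->; rewrite !scaler0.
  rewrite rowE trmx_mul trmx_delta -!mulmxA [H *m _]mulmxA [P0 *m _]mulmxA.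
  rewrite [P0 *m _]mulmxA -/H1 mulmxA -rowE -colE.
  by apply/matrixP=> i j; rewrite [LHS]mxE [LHS]mxE [RHS]mxE; exact: c0.
have eH1 : H1 = block_mx c%:M b b^T C.
  rewrite -[LHS]submxK; congr block_mx; last by rewrite -[in LHS]symH1 trmx_ursub.
  exact: ulsubmx_scalar.
have symC : C^T = C by rewrite /C trmx_drsub symH1.
have symC' : (C - c^-1 *: (b^T *m b))^T = C - c^-1 *: (b^T *m b).
  by rewrite linearB linearZ /= trmx_mul trmxK symC.
move: eH1; rewrite (complete_square _ _ (divff nzc)).
set F := block_mx _ _ _ _; set C' := C - _ in symC' * => eH1.
have uF : F \in unitmx by rewrite unitmxE det_ublock !det1 mulr1 unitr1.
have [P' uP' [d' ed' rd']] := IH C' symC'.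
pose Q : 'M[K]_(1 + n) := block_mx 1%:M 0 0 P'.
have uQ : Q \in unitmx by rewrite unitmxE det_ublock det1 mul1r -unitmxE.
pose P : 'M[K]_n.+1 := Q *m F *m invmx P0^T.
have eH : H = P^T *m diag_mx (row_mx c%:M d') *m P.
  have -> : H = invmx P0 *m H1 *m invmx P0^T.
    by rewrite /H1 -!mulmxA mulmxV ?unitmx_tr // mulmx1 mulKmx.
  have -> : P^T *m diag_mx (row_mx c%:M d') *m P = invmx P0 *m
      (F^T *m (Q^T *m diag_mx (row_mx c%:M d') *m Q) *m F) *m invmx P0^T.
    by rewrite /P !trmx_mul trmx_inv trmxK !mulmxA.
  congr (_ *m _ *m _); rewrite eH1; congr (_ *m _ *m _).
  rewrite diag_mx_row /Q tr_block_mx trmx1 !trmx0 !mulmx_block.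
  rewrite !(mul1mx, mul0mx, mulmx1, mulmx0, addr0, add0r) ed'; congr block_mx.
  by apply/matrixP=> i j; rewrite !ord1 !mxE.
have uP : P \in unitmx by rewrite !unitmx_mul uQ uF unitmx_inv unitmx_tr.
exists P => //; exists (row_mx c%:M d') => //.
have rc : \rank (diag_mx (c%:M : 'rV_1)) = 1%N.
  apply/eqP; rewrite -/(row_free _) row_free_unit unitmxE det_diag big_ord1.
  by rewrite mxE eqxx mulr1n unitfE.
have rkD : \rank (diag_mx (row_mx c%:M d' : 'rV_(1 + n))) = (1 + \rank C')%N.
  by rewrite diag_mx_row rank_diag_block_mx rc [in RHS]ed' mxrank_congr.
have rkH : \rank H = (1 + \rank C')%N by rewrite eH mxrank_congr.
apply: (@ord_split_ind 1 n) => i; rewrite rkH.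
  by rewrite (row_mxEl (c%:M : 'rV_1) d') mxE !ord1 eqxx mulr1n nzc.
by rewrite (row_mxEr (c%:M : 'rV_1) d') rd'.
Qed.

End Symmetric.

Section Cholesky.
Variables (K : fieldType) (n : nat).
Local Notation A := (algps K n).

Lemma algps_sqrt (f : A) (a : K) : (2%:R : K) != 0 -> a != 0 -> fps_coef f 0%MM = a ->
  exists2 s : A, fps_coef s 0%MM = 1 & a *: s ^+ 2 = f.
Proof.
move=> nz2 nza fa; have f1 : fps_coef (a^-1 *: f) 0%MM = 1 by rewrite fps_coefZ fa mulVf.
have [s s1 es] := fps_sqrt nz2 f1.
have as_ : s \in fps_alg by apply: fps_alg_sqrt es; rewrite rpredZ ?algps_valP.
exists (AlgPs as_) => //; apply: algps_val_inj.
rewrite -[LHS]/(a *: s ^+ 2) es scalerA divff // scale1r //.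
Qed.

Definition algps_const (f : A) : K := fps_coef f 0%MM.

Fact algps_const_zmod : zmod_morphism algps_const.
Proof. by []. Qed.
HB.instance Definition _ := GRing.isZmodMorphism.Build A K
  algps_const algps_const_zmod.

Fact algps_const_monoid : monoid_morphism algps_const.
Proof.
by split=> [|f g]; rewrite /algps_const ?fps_coef1 ?eqxx // -fps_coefM0.
Qed.
HB.instance Definition _ := GRing.isMonoidMorphism.Build A K
  algps_const algps_const_monoid.

(** Elimination as over a field: each pivot has a non-zero constant term [a 0 i],
    hence it is invertible and equal to [a 0 i] times a square. *)
Lemma algps_cholesky k (C : 'M[A]_k) (a : 'rV[K]_k) : (2%:R : K) != 0 -> C^T = C ->
    (forall i, a 0 i != 0) -> map_mx algps_const C = diag_mx a ->
  exists2 B : 'M[A]_k, map_mx algps_const B = 1%:M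
    & C = B^T *m diag_mx (map_mx (in_alg A) a) *m B.
Proof.
move=> nz2; elim: k C a => [|k IH] C a sym nza eC0.
  by exists 1%:M; apply/matrixP => -[].
pose C1 : 'M[A]_(1 + k) := C; have symC1 : C1^T = C1 := sym.
pose c := C1 0 0; pose b := ursubmx C1; pose C2 := drsubmx C1.
pose a1 : 'rV[K]_(1 + k) := a.
have {}eC0 : map_mx algps_const C1 = block_mx (diag_mx (lsubmx a1)) 0 0 (diag_mx (rsubmx a1)).
  by rewrite -diag_mx_row hsubmxK -eC0.
have c0 : algps_const c = a 0 0.
  have /matrixP/(_ 0 0) : map_mx algps_const (ulsubmx C1) = diag_mx (lsubmx a1).
    by rewrite map_ulsubmx eC0 block_mxKul.
  rewrite ulsubmx_scalar !mxE !eqxx !mulr1n => ->.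
  by congr (a _ _); apply: val_inj.
have b0 : map_mx algps_const b = 0 by rewrite map_ursubmx eC0 block_mxKur.
have C20 : map_mx algps_const C2 = diag_mx (rsubmx a1).
  by rewrite map_drsubmx eC0 block_mxKdr.
have [s s1 es] := algps_sqrt nz2 (nza 0) c0.
have [t st] : exists t, s * t = 1 by apply: algps_inverse; rewrite s1 oner_eq0.
pose u := (a 0 0)^-1 *: t ^+ 2.
have cu : c * u = 1.
  rewrite -es /u -scalerAl -scalerAr scalerA divff // scale1r.
  by rewrite -exprMn st expr1n.
have eC : C1 = block_mx c%:M b b^T C2.
  rewrite -[LHS]submxK; congr block_mx; last by rewrite -[in LHS]symC1 trmx_ursub.
  exact: ulsubmx_scalar.
have symC' : (C2 - u *: (b^T *m b))^T = C2 - u *: (b^T *m b).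
  by rewrite linearB linearZ /= trmx_mul trmxK /C2 trmx_drsub symC1.
move: eC; rewrite (complete_square _ _ cu).
set F := block_mx _ _ _ _; set C' := C2 - _ in symC' * => eC.
have [||B' B'0 eB'] := IH C' (rsubmx a1) symC'.
- by move=> i; rewrite mxE; apply: nza.
- by rewrite map_mxB map_mxZ map_mxM b0 mulmx0 scaler0 subr0 C20.
pose Q : 'M[A]_(1 + k) := block_mx s%:M 0 0 B'.
have eQF : map_mx algps_const (Q *m F) = 1%:M.
  rewrite map_mxM /Q /F !map_block_mx !map_mx0 B'0 !map_scalar_mx map_mxZ b0 scaler0.
  by rewrite !rmorph1 /= /algps_const s1 -!scalar_mx_block mulmx1.
exists (Q *m F); first exact: eQF.
pose D : 'M[A]_(1 + k) := diag_mx (map_mx (in_alg A) a1).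
transitivity (F^T *m (Q^T *m D *m Q) *m F); last by rewrite trmx_mul !mulmxA.
rewrite -[LHS]/C1 eC; congr (_ *m _ *m _); rewrite /D.
have -> : map_mx (in_alg A) a1 = row_mx ((a 0 0)%:A)%:M (map_mx (in_alg A) (rsubmx a1)).
  rewrite -[in LHS](hsubmxK a1) map_row_mx; congr row_mx.
  apply/matrixP=> i j; rewrite !ord1 !mxE eqxx mulr1n /=.
  by congr (a _ _ *: _); apply: val_inj.
rewrite diag_mx_row /Q tr_block_mx !trmx0 tr_scalar_mx !mulmx_block.
rewrite !(mul1mx, mul0mx, mulmx1, mulmx0, addr0, add0r) eB'; congr block_mx.
rewrite -es; apply/matrixP=> i j; rewrite !ord1 !mxE !big_ord1 !mxE !big_ord1 !mxE.
by rewrite !eqxx !mulr1n -scalerAr mulr1 -scalerAl expr2.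
Qed.

End Cholesky.

(** * Series in the last variables *)

Section HeadTail.
Variables (K : fieldType) (n k : nat).
Local Notation tail_ord := (@tail_ord n k).

Lemma tail_ord_inj : injective tail_ord.
Proof. by move=> i j /(congr1 val) /= /addnI /val_inj. Qed.

Lemma tail_ord_ge (j : 'I_(n - k)) : (tail_ord j < k)%N = false.
Proof. by rewrite ltnNge leq_addr. Qed.

Lemma ord_head_tail_ind (P : 'I_n -> Prop) :
  (forall i : 'I_n, (i < k)%N -> P i) -> (forall j, P (tail_ord j)) -> forall i, P i.
Proof.
move=> Ph Pt i; have [/Ph//|ge] := ltnP i k.
have lt : (i - k < n - k)%N by rewrite ltn_sub2r // (leq_ltn_trans ge).
by rewrite (_ : i = tail_ord (Ordinal lt)) //; apply: val_inj; rewrite /= subnKC.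
Qed.

Definition psub_tail : psub K (n - k) n :=
  Psub (fun j => fps_ord_X K (tail_ord j)).

Fact psub_rest_subproof (i : 'I_n) :
  fps_ord 1 (\sum_(j | tail_ord j == i) fps_X j : fps K (n - k)).
Proof. by apply: fps_ord_sum => j _; exact: fps_ord_X. Qed.

(** The first [k] variables go to zero and the others to the variables of the
    smaller ring: the sum has no term in the first case and one in the second. *)
Definition psub_rest : psub K n (n - k) := Psub psub_rest_subproof.

Lemma psub_rest_tail j : psub_rest (tail_ord j) = fps_X j.
Proof. by rewrite /= (big_pred1 j) // => l; rewrite /= (inj_eq tail_ord_inj). Qed.

Lemma psub_rest_head (i : 'I_n) : (i < k)%N -> psub_rest i = 0.
Proof.
by move=> lt; rewrite /= big_pred0 // => j; apply: contraTF lt => /eqP <-; rewrite tail_ord_ge.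
Qed.

Lemma fps_alg_rest i : psub_rest i \in fps_alg.
Proof. by rewrite /= rpred_sum // => j _; exact: fps_algX. Qed.

Lemma fps_rest_tail : cancel (fps_subst psub_tail) (fps_subst psub_rest).
Proof. by apply: fps_subst_cancel => j; rewrite fps_substX psub_rest_tail. Qed.

Lemma fps_tail_rest f : fps_subst psub_tail (fps_subst psub_rest f) =
  fps_subst (kill K [pred i : 'I_n | (i < k)%N]) f.
Proof.
apply: fps_subst_comp; apply: ord_head_tail_ind => [i lt|j].
  by rewrite psub_rest_head // rmorph0 /= lt.
by rewrite psub_rest_tail fps_substX /= tail_ord_ge.
Qed.

Lemma fps_tail_scalable : scalable (@fps_tail n k K).
Proof. by move=> c f; apply/fpsP=> m /=; case: ifP; rewrite ?mulr0. Qed.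
HB.instance Definition _ := GRing.isScalable.Build K (fps K (n - k)) (fps K n) *:%R
  (@fps_tail n k K) fps_tail_scalable.

Lemma fps_tail_subst g : fps_tail g = fps_subst psub_tail g.
Proof.
pose theta : {lrmorphism fps K (n - k) -> fps K n} := @fps_tail n k K.
rewrite -[LHS]/(theta g); apply: fps_morph_subst => j.
have -> : theta (fps_X j) = fps_of_mpoly (@mpoly_tail n k K 'X_j).
  by apply/fpsP=> m; rewrite /= mcoeff_tail.
by rewrite /mpoly_tail mmapX mmap1U.
Qed.

Lemma head_sum (V : nmodType) (le : (k <= n)%N) (F : 'I_n -> V) :
  \sum_(i < n | (i < k)%N) F i = \sum_(i < k) F (widen_ord le i).
Proof. by rewrite big_ord_narrow. Qed.

Lemma tail_sum (V : nmodType) (F : 'I_n -> V) :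
  \sum_(i < n | ~~ (i < k)%N) F i = \sum_j F (tail_ord j).
Proof.
rewrite -(big_imset F (h := tail_ord) (A := predT)) /=; last first.
  by move=> ? ? _ _; exact: tail_ord_inj.
apply: eq_bigl; apply: ord_head_tail_ind => [i lt|j]; last first.
  by rewrite tail_ord_ge imset_f.
rewrite lt; apply/esym/negbTE/imsetP => -[j _ e].
by move: lt; rewrite e tail_ord_ge.
Qed.

Lemma split_form_val (a : 'I_n -> K) (g : algps K (n - k)) :
  split_form a g = \sum_(i < n | (i < k)%N) a i *: fps_X i ^+ 2
                   + fps_subst psub_tail g :> fps K n.
Proof.
rewrite -fps_tail_subst -[LHS]/(algps_val (\sum_(i < n | (i < k)%N) _) + _).
by rewrite algps_val_sum.
Qed.

End HeadTail.

(** * Existence of a splitting *)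

Section Taylor.
Variables (K : fieldType) (n : nat).

Definition psub_add : psub K n (n + n) :=
  Psub (fun i => fps_ordD (fps_ord_X K (lshift n i)) (fps_ord_X K (rshift n i))).

Lemma lshift_sum m (V : nmodType) (F : 'I_(m + n) -> V) :
  \sum_(i : 'I_(m + n) | (i < m)%N) F i = \sum_i F (lshift n i).
Proof.
rewrite big_mkcond big_split_ord /= [X in _ + X]big1 ?addr0 => [|i _].
  by apply: eq_bigr => i _; rewrite ltn_ord.
by rewrite ltnNge leq_addr.
Qed.

(** The expansion of [f (x + v)] to second order in [v], obtained by dividing
    by the variables [v] twice. This is how the first derivatives of an
    algebraic series are seen to be algebraic in every characteristic. *)
Lemma fps_alg_taylor (f : fps K n) : f \in fps_alg -> fps_ord 2 f ->
  exists (b : 'I_n -> fps K n) (c : 'I_n -> 'I_n -> fps K (n + n)),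
  [/\ forall i, b i \in fps_alg, forall i j, c i j \in fps_alg,
      forall i, fps_ord 1 (b i),
      forall i j, fps_coef (b i) U_(j)%MM = hessian f i j
    & fps_subst psub_add f = fps_subst (psub_rshift K n n) f
      + \sum_i fps_X (lshift n i) * fps_subst (psub_rshift K n n) (b i)
      + \sum_i \sum_j fps_X (lshift n i) * (fps_X (lshift n j) * c i j)].
Proof.
move=> af o2; set emb := psub_rshift K n n.
pose S := [pred i : 'I_(n + n) | (i < n)%N].
have aF : fps_subst psub_add f \in fps_alg.
  by apply: fps_alg_subst => // i; rewrite rpredD ?fps_algX.
have oF : fps_ord 2 (fps_subst psub_add f) by exact: fps_ord_subst.
pose h i := fps_divX S (lshift n i) (fps_subst psub_add f).
have ah i : h i \in fps_alg by exact: fps_alg_divX.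
have oh i : fps_ord 1 (h i) by exact: fps_ord_divX.
pose b i := fps_subst (psub_drop K n n) (h i).
pose c i j := fps_divX S (lshift n j) (h i).
have emb_drop g : fps_subst emb (fps_subst (psub_drop K n n) g) = fps_subst (kill K S) g.
  apply: fps_subst_comp; apply: ord_split_ind => i.
    by rewrite psub_pairl rmorph0 /= ltn_ord.
  by rewrite psub_pairr fps_substX /= ltnNge leq_addr.
have eh i : h i = fps_subst emb (b i) + \sum_j fps_X (lshift n j) * c i j.
  by rewrite {1}(fps_divXP S (h i)) -emb_drop (lshift_sum (fun j => fps_X j * _)).
have eF : fps_subst psub_add f = fps_subst emb f + \sum_i fps_X (lshift n i) * h i.
  rewrite {1}(fps_divXP S (fps_subst psub_add f)) -emb_drop.
  rewrite (lshift_sum (fun j => fps_X j * _)); congr (fps_subst emb _ + _).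
  apply: fps_subst_cancel => i.
  by rewrite rmorphD /= !fps_substX psub_pairl psub_pairr add0r.
have ob i : fps_ord 1 (b i) by exact: fps_ord_subst.
exists b, c; split=> //.
- by move=> i; exact: fps_alg_drop.
- by move=> i j; exact: fps_alg_divX.
- move=> i j.
  have jemb_l p q : jac emb p (lshift n q) = 0.
    by rewrite mxE fps_coefXU eq_rlshift.
  have jemb_r p q : jac emb p (rshift n q) = (p == q)%:R.
    by rewrite mxE fps_coefXU (inj_eq (@rshift_inj _ _)).
  have jadd_l p q : jac psub_add p (lshift n q) = (p == q)%:R.
    by rewrite mxE fps_coefD !fps_coefXU eq_rlshift addr0 (inj_eq (@lshift_inj _ _)).
  have jadd_r p q : jac psub_add p (rshift n q) = (p == q)%:R.
    by rewrite mxE fps_coefD !fps_coefXU eq_lrshift add0r (inj_eq (@rshift_inj _ _)).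
  have : hessian (fps_subst psub_add f) (lshift n i) (rshift n j) = hessian f i j.
    rewrite hessian_subst // mxE (bigD1 j) //= big1 => [|q ne]; last first.
      by rewrite jadd_r (negbTE ne) mulr0.
    rewrite jadd_r eqxx mulr1 addr0 mxE (bigD1 i) //= big1 => [|q ne]; last first.
      by rewrite mxE jadd_l (negbTE ne) mul0r.
    by rewrite mxE jadd_l eqxx mul1r addr0.
  have Hemb : hessian (fps_subst emb f) (lshift n i) (rshift n j) = 0.
    rewrite hessian_subst // mxE big1 // => q _.
    by rewrite mxE big1 ?mul0r // => p _; rewrite mxE jemb_l mul0r.
  rewrite eF hessianD Hemb add0r hessian_sum => <-.
  under eq_bigr => l _ do
    rewrite hessian_mulX eq_rlshift mulr0n addr0 (inj_eq (@lshift_inj _ _)).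
  rewrite sumr_delta eh fps_coefD fps_linear_subst // fps_coef_sum.
  rewrite [X in _ + X]big1 ?addr0 => [|q _]; last first.
    by rewrite fps_coefXM mnm1E eq_rlshift.
  rewrite (bigD1 j) //= big1 ?addr0 => [|q ne].
    by rewrite mcoeffXU eqxx mulr1.
  by rewrite mcoeffXU (inj_eq (@rshift_inj _ _)) (negbTE ne) mulr0.
rewrite eF -addrA; congr (_ + _); rewrite -big_split; apply: eq_bigr => i _.
by rewrite [in LHS]eh mulrDr mulr_sumr.
Qed.

End Taylor.

Section Existence.
Variables (K : fieldType) (n k : nat).
Hypothesis nz2 : (2%:R : K) != 0.
Hypothesis le_kn : (k <= n)%N.
Local Notation head := [pred i : 'I_n | (i < k)%N].
Local Notation hd := (widen_ord le_kn).
Local Notation tail := (fps_subst (psub_tail K n k)).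
Local Notation rest := (fps_subst (psub_rest K n k)).

Lemma hessian_tail g (i j : 'I_n) : fps_ord 2 g -> (i < k)%N || (j < k)%N ->
  hessian (tail g) i j = 0.
Proof.
move=> o2; wlog lt : i j / (i < k)%N => [wl /orP[] lt|_].
- by apply: wl => //; rewrite lt.
- by rewrite -hessian_sym mxE; apply: wl => //; rewrite lt.
rewrite hessian_subst // mxE big1 // => l _; rewrite mxE big1 ?mul0r // => p _.
rewrite !mxE fps_coefXU (_ : tail_ord _ == i = false) ?mul0r //.
by apply: contraTF lt => /eqP <-; rewrite tail_ord_ge.
Qed.

(** Translating the variables [x_i], [i < k], to the locus where the partial
    derivatives in these variables vanish removes all terms of degree one in
    these variables. *)
Lemma fps_alg_critical (f : fps K n) (d : 'rV[K]_n) :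
    f \in fps_alg -> fps_ord 2 f -> hessian f = diag_mx d ->
    (forall i : 'I_n, (d 0 i != 0) = (i < k)%N) ->
  exists (mu : psub K n n) (g : fps K (n - k)) (c : 'I_k -> 'I_k -> fps K n),
  [/\ forall i, mu i \in fps_alg, jac mu = 1%:M, g \in fps_alg /\ fps_ord 2 g,
      forall i j, c i j \in fps_alg
    & fps_subst mu f = tail g
        + \sum_i \sum_j fps_X (hd i) * (fps_X (hd j) * c i j)].
Proof.
move=> af o2 eH dP; have [b [c [ab ac ob bH eT]]] := fps_alg_taylor af o2.
set emb := psub_rshift K n n in eT.
have oPhi (i : 'I_n) : fps_ord 1 (if (i < k)%N then b i else fps_X i).
  by case: ifP => _ //; exact: fps_ord_X.
pose Phi : psub K n n := Psub oPhi.
have aPhi i : Phi i \in fps_alg.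
  by rewrite /=; case: ifP => _; [exact: ab | exact: fps_algX].
have jPhi : jac Phi = diag_mx (\row_i (if (i < k)%N then d 0 i else 1)).
  apply/matrixP=> i j; rewrite 3!mxE /=; case: ifP => lt; last exact: fps_coefXU.
  by rewrite bH eH mxE.
have uPhi : jac Phi \in unitmx.
  rewrite jPhi unitmxE det_diag unitfE; apply/prodf_neq0 => i _; rewrite mxE.
  by case: ifP => [lt|_]; [rewrite dP | exact: oner_neq0].
have [G [aG _ canG _]] := fps_alg_inverse_function uPhi aPhi.
have GPhi i : fps_subst G (Phi i) = fps_X i by rewrite -fps_substX canG.
have GX (i : 'I_n) : (i < k)%N = false -> G i = fps_X i.
  by move=> hi; rewrite -fps_substX -[RHS]GPhi /= hi.
(* [p] parametrises the locus where the [b i], [i < k], vanish. *)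
pose p := psub_comp G (kill K head).
have ap i : p i \in fps_alg by apply: fps_alg_kill.
have pX (i : 'I_n) : (i < k)%N = false -> p i = fps_X i.
  by move=> hi; rewrite /= GX // fps_substX /= hi.
have pb (i : 'I_n) : (i < k)%N -> fps_subst p (b i) = 0.
  move=> hi; rewrite psub_compE; have := GPhi i; rewrite /= hi => ->.
  by rewrite fps_substX /= hi.
have p_lin (i j : 'I_n) : (i < k)%N -> fps_coef (p i) U_(j)%MM = 0.
  move=> hi; have nzd : d 0 i != 0 by rewrite dP.
  have := congr1 (fun h => fps_coef h U_(j)%MM) (pb _ hi).
  rewrite fps_linear_subst // (bigD1 i) // big1 => [|l ne]; last first.
    by rewrite bH eH mxE eq_sym (negbTE (ne : l != i)) mul0r.
  rewrite bH eH mxE eqxx mulr1n => e; apply: (mulfI nzd); rewrite mulr0.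
  by rewrite -[LHS]addr0; exact: e.
pose V := kill K [pred i : 'I_n | ~~ (i < k)%N].
have VE (i : 'I_n) : V i = if (i < k)%N then fps_X i else 0 by rewrite /= if_neg.
have aV i : V i \in fps_alg.
  by rewrite /=; case: ifP => _; [exact: rpred0 | exact: fps_algX].
pose chi := psub_pair V p.
have achi i : chi i \in fps_alg.
  by move: i; apply: ord_split_ind => i; rewrite ?psub_pairl ?psub_pairr.
pose mu := psub_comp (psub_add K n) chi.
have emu i : mu i = V i + p i.
  by rewrite /= rmorphD /= !fps_substX psub_pairl psub_pairr.
have chi_emb g : fps_subst chi (fps_subst emb g) = fps_subst p g.
  by apply: fps_subst_comp => i; rewrite fps_substX psub_pairr.
pose g := rest (fps_subst G f).
exists mu, g, (fun i j => fps_subst chi (c (hd i) (hd j))); split.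
- by move=> i; rewrite emu rpredD.
- apply/matrixP=> i j; rewrite 2!mxE emu fps_coefD.
  have [hi|hi] := boolP (i < k)%N.
    by rewrite p_lin // addr0 VE hi fps_coefXU.
  by rewrite pX ?VE (negbTE hi) // add0r fps_coefXU.
- split; last by do 2!apply: fps_ord_subst.
  by apply: fps_alg_subst; [exact: fps_alg_rest | exact: fps_alg_subst].
- by move=> i j; exact: fps_alg_subst.
rewrite psub_compE eT !rmorphD /= chi_emb !rmorph_sum /=.
have headE (F : 'I_n -> fps K n) : \sum_i V i * F i = \sum_(i : 'I_k) fps_X (hd i) * F (hd i).
  rewrite -(head_sum le_kn (fun i => fps_X i * F i)) [RHS]big_mkcond.
  by apply: eq_bigr => i _; rewrite VE; case: ifP; rewrite ?mul0r.
congr (_ + _).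
  rewrite fps_tail_rest -psub_compE big1 ?addr0 // => i _.
  rewrite rmorphM /= fps_substX psub_pairl chi_emb VE.
  by case: ifP => [hi|_]; rewrite ?mul0r // pb ?mulr0.
under eq_bigr => i _.
  rewrite rmorph_sum; under eq_bigr => j _.
    rewrite !rmorphM /= !fps_substX !psub_pairl mulrCA.
    over.
  rewrite headE.
  over.
rewrite /= exchange_big [RHS]exchange_big; apply: eq_bigr => j _ /=.
by under eq_bigr do rewrite mulrCA; rewrite headE; apply: eq_bigr => i _; rewrite mulrCA.
Qed.

Lemma hd_eq (i : 'I_k) (p : 'I_n) : ~~ (p < k)%N -> (hd i == p) = false.
Proof. by apply: contraNF => /eqP <- /=. Qed.

Lemma hessian_quadratic (c : 'I_k -> 'I_k -> fps K n) (p q : 'I_n) :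
  hessian (\sum_i \sum_j fps_X (hd i) * (fps_X (hd j) * c i j)) p q =
  \sum_i \sum_j ((p == hd i) && (q == hd j))%:R * fps_coef (c i j) 0%MM +
  \sum_i \sum_j ((q == hd i) && (p == hd j))%:R * fps_coef (c i j) 0%MM.
Proof.
rewrite hessian_sum -big_split; apply: eq_bigr => i _ /=.
rewrite hessian_sum -big_split; apply: eq_bigr => j _ /=.
have eXc r : fps_coef (fps_X (hd j) * c i j) U_(r)%MM =
    (r == hd j)%:R * fps_coef (c i j) 0%MM.
  rewrite mulrC fps_coef_mulU; last exact: fps_ord_X.
  by rewrite fps_coefXU eq_sym mulrC.
rewrite hessian_mulX !eXc; congr (_ + _).
  by rewrite -[LHS]mulr_natr mulrAC -natrM mulnb andbC.
by rewrite -[LHS]mulr_natr mulrAC -natrM mulnb andbC.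
Qed.

(** The symmetrised matrix of the [c i j] is half the Hessian of [f] at the origin,
    so it is congruent to its value there by a matrix [B] tangent to the identity;
    the rows of [B] are the new coordinates. That the Hessian of [f] has no other
    entries forces [h] to have order 3. *)
Lemma fps_alg_diagonalize (f : fps K n) (h : fps K (n - k)) (d : 'rV[K]_n)
    (c : 'I_k -> 'I_k -> fps K n) :
    f = tail h + \sum_i \sum_j fps_X (hd i) * (fps_X (hd j) * c i j) ->
    hessian f = diag_mx d -> (forall i : 'I_n, (d 0 i != 0) = (i < k)%N) ->
    fps_ord 2 h -> (forall i j, c i j \in fps_alg) ->
  fps_ord 3 h /\ exists omega : psub K n n,
  [/\ forall i, omega i \in fps_alg, jac omega = 1%:M
    & f = fps_subst omega (\sum_(i < n | (i < k)%N) (d 0 i / 2%:R) *: fps_X i ^+ 2 + tail h)].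
Proof.
move=> ef eH dP oh ac.
have eHf p q : hessian f p q =
    hessian (tail h) p q + (\sum_i \sum_j ((p == hd i) && (q == hd j))%:R * fps_coef (c i j) 0%MM +
    \sum_i \sum_j ((q == hd i) && (p == hd j))%:R * fps_coef (c i j) 0%MM).
  by rewrite ef hessianD hessian_quadratic.
split.
  suff o3 : fps_ord 3 (tail h).
    by rewrite -[h](fps_rest_tail (k := k)); exact: fps_ord_subst.
  apply/(fps_ord3P nz2); first exact: fps_ord_subst.
  apply/matrixP=> p q; rewrite [RHS]mxE.
  have [lt|] := boolP ((p < k)%N || (q < k)%N); first exact: hessian_tail.
  rewrite negb_or => /andP[gep geq].
  have := eHf p q; rewrite eH mxE [X in _ + (X + _)]big1 => [|i _]; last first.
    by rewrite big1 // => j _; rewrite eq_sym hd_eq // mul0r.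
  rewrite [X in _ + (_ + X)]big1 => [|i _]; last first.
    by rewrite big1 // => j _; rewrite eq_sym hd_eq // mul0r.
  rewrite !addr0 => <-; case: eqP => // _.
  by move: gep; rewrite -dP negbK => /eqP ->.
pose C := \matrix_(i, j) (2%:R^-1 *: (AlgPs (ac i j) + AlgPs (ac j i))) : 'M[algps K n]_k.
pose a := \row_i (d 0 (hd i) / 2%:R) : 'rV[K]_k.
have symC : C^T = C by apply/matrixP=> i j; rewrite !mxE addrC.
have nza i : a 0 i != 0.
  by rewrite mxE mulf_neq0 ?invr_eq0 // dP /=.
have hd_inj : injective hd by move=> i j /(congr1 val) /= /val_inj.
have sum_hd (F : 'I_k -> 'I_k -> K) p q :
    \sum_i \sum_j ((hd p == hd i) && (hd q == hd j))%:R * F i j = F p q.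
  rewrite (bigD1 p) //= (bigD1 q) //= !eqxx mul1r !big1 ?addr0 // => [i ne|j ne].
    by rewrite big1 // => j _; rewrite (inj_eq hd_inj) eq_sym (negbTE ne) mul0r.
  by rewrite (inj_eq hd_inj) eq_sym (negbTE ne) mul0r.
have C0 : map_mx (@algps_const K n) C = diag_mx a.
  apply/matrixP=> i j; rewrite !mxE.
  have := eHf (hd i) (hd j); rewrite hessian_tail ?add0r //= ?ltn_ord //.
  rewrite !sum_hd eH mxE (inj_eq hd_inj) => e.
  rewrite /algps_const fps_coefZ fps_coefD -e.
  by rewrite mulrC mulrnAl.
have [B B1 eC] := algps_cholesky nz2 symC nza C0.
pose w i : fps K n := \sum_j algps_val (B i j) * fps_X (hd j).
have ow i : fps_ord 1 (if insub (val i) is Some i' then w i' else fps_X i).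
  case: insubP => [i' _ _|_]; last exact: fps_ord_X.
  by apply: fps_ord_sum => j _; apply: fps_ordMr; exact: fps_ord_X.
pose omega : psub K n n := Psub ow.
have omega_hd i : omega (hd i) = w i.
  by rewrite /= insubT //= => lt; congr w; apply: val_inj.
have omega_tl (i : 'I_n) : ~~ (i < k)%N -> omega i = fps_X i.
  by move=> ge; rewrite /= insubN.
have hdP (i : 'I_n) (lt : (i < k)%N) : i = hd (Ordinal lt) by apply: val_inj.
have B0 i j : fps_coef (B i j) 0%MM = (i == j)%:R.
  by move/matrixP/(_ i j): B1; rewrite !mxE.
exists omega; split.
- move=> i; have [lt|ge] := boolP (i < k)%N; last by rewrite omega_tl ?fps_algX.
  rewrite (hdP _ lt) omega_hd rpred_sum // => j _.
  by rewrite rpredM ?algps_valP ?fps_algX.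
- apply/matrixP=> i q; rewrite 2!mxE; have [lt|ge] := boolP (i < k)%N; last first.
    by rewrite omega_tl // fps_coefXU.
  rewrite (hdP _ lt) omega_hd fps_coef_sum; set i' := Ordinal lt.
  have e j : fps_coef (algps_val (B i' j) * fps_X (hd j)) U_(q)%MM =
      (i' == j)%:R * (hd j == q)%:R.
    by rewrite fps_coef_mulU ?B0 ?fps_coefXU //; exact: fps_ord_X.
  under eq_bigr => j _ do rewrite e.
  rewrite (bigD1 i') //= big1 ?addr0 => [|j ne]; last first.
    by rewrite eq_sym (negbTE ne) mul0r.
  by rewrite eqxx mul1r.
have eCjl j l : algps_val (C j l) =
    \sum_i a 0 i *: (algps_val (B i j) * algps_val (B i l)).
  rewrite [in LHS]eC mul_mx_diag mxE algps_val_sum; apply: eq_bigr => i _.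
  rewrite [a]lock !mxE -lock -[LHS]/(algps_val (B i j) * (a 0 i)%:A * algps_val (B i l)).
  by rewrite -mulrA mulr_algl scalerAr.
rewrite rmorphD /=.
rewrite [fps_subst omega (tail h)](fps_subst_comp (chi := psub_tail K n k)); last first.
  by move=> j; rewrite fps_substX omega_tl // tail_ord_ge.
rewrite ef addrC; congr (_ + _).
pose X i : fps K n := fps_X (hd i).
pose S := \sum_i \sum_j X i * (X j * c i j).
transitivity (\sum_i \sum_j X i * (X j * C i j)).
  have -> : \sum_i \sum_j X i * (X j * algps_val (C i j)) = 2%:R^-1 *: (S + S).
    rewrite /S [X in _ *: (_ + X)]exchange_big -big_split scaler_sumr; apply: eq_bigr => i _.
    rewrite -big_split scaler_sumr; apply: eq_bigr => j _ /=.
    rewrite [C i j]mxE -[algps_val _]/(2%:R^-1 *: (c i j + c j i)).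
    by rewrite -!scalerAr !mulrDr (mulrCA (X j)).
  by rewrite -mulr2n -scaler_nat scalerA mulVf // scale1r.
rewrite (head_sum le_kn) rmorph_sum /=.
transitivity (\sum_i \sum_j \sum_l
    a 0 l *: ((algps_val (B l i) * X i) * (algps_val (B l j) * X j))).
  apply: eq_bigr => i _; apply: eq_bigr => j _; rewrite eCjl !mulr_sumr.
  apply: eq_bigr => l _; rewrite -!scalerAr; congr (_ *: _).
  by rewrite mulrACA mulrA mulrC.
rewrite exchange_big /=; under eq_bigr do rewrite exchange_big /=.
rewrite exchange_big /=; apply: eq_bigr => l _.
rewrite linearZ rmorphXn /= fps_substX omega_hd.
under eq_bigr do rewrite -scaler_sumr -mulr_suml.
by rewrite -scaler_sumr -mulr_sumr mxE.
Qed.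

End Existence.

Lemma splitting_exists (K : fieldType) n k (f : algps K n) : (2%:R : K) != 0 ->
    fps_ord 2 f -> \rank (hessian f) = k ->
  exists (a : 'I_n -> K) (g : algps K (n - k)), is_splitting f a g.
Proof.
move=> nz2 o2 rk; have le_kn : (k <= n)%N by rewrite -rk rank_leq_row.
have [P uP [d eH]] := sym_diagonalize nz2 (hessian_sym f); rewrite rk => dP.
pose lambda := psub_mx (invmx P).
have alambda := fps_alg_mx (invmx P).
have af1 : fps_subst lambda f \in fps_alg by apply: fps_alg_subst; last exact: algps_valP.
have of1 : fps_ord 2 (fps_subst lambda f) by exact: fps_ord_subst.
have eH1 : hessian (fps_subst lambda f) = diag_mx d.
  rewrite hessian_subst // jac_mx eH !mulmxA -trmx_mul mulmxV // trmx1 mul1mx.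
  by rewrite mulmxK.
have [mu [g [c [amu jmu [ag og] ac e2]]]] := fps_alg_critical le_kn af1 of1 eH1 dP.
have eH2 : hessian (fps_subst mu (fps_subst lambda f)) = diag_mx d.
  by rewrite hessian_subst // jmu trmx1 mul1mx mulmx1.
have [og3 [omega [aomega jomega e3]]] := fps_alg_diagonalize nz2 e2 eH2 dP og ac.
exists (fun i => d 0 i / 2%:R), (AlgPs ag); split.
- by move=> i lt; rewrite mulf_neq0 ?invr_eq0 ?dP.
- exact/idealX_ordP.
apply: (@right_equiv_trans _ _ (algps_subst (fps_alg_comp alambda amu) f)).
  apply/right_equivP; exists (psub_comp lambda mu); split=> //.
    exact: fps_alg_comp.
  by rewrite jac_compE jac_mx jmu mulmx1 unitmx_inv.
apply: right_equiv_sym; apply/right_equivP; exists omega; split=> //.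
  by rewrite jomega unitmx1.
by rewrite split_form_val -e3 /= psub_compE.
Qed.

(** * Uniqueness of the residual part *)

Section Uniqueness.
Variables (K : fieldType) (n k : nat).
Hypothesis nz2 : (2%:R : K) != 0.
Local Notation tail := (fps_subst (psub_tail K n k)).
Local Notation rest := (fps_subst (psub_rest K n k)).
Local Notation tl := (@tail_ord n k).
Implicit Types (a : 'I_n -> K) (g : algps K (n - k)).

Definition head_diag a : 'rV[K]_n := \row_i (if (i < k)%N then a i else 0).

Lemma hessian_split a g : fps_ord 3 g ->
  hessian (split_form a g) = 2%:R *: diag_mx (head_diag a).
Proof.
move=> og; rewrite split_form_val raddfD /= (hessian_ord3 (fps_ord_subst _ og)) addr0.
apply/matrixP=> p q; rewrite hessian_sum.
have e i : hessian (a i *: fps_X i ^+ 2) p q = 2%:R * a i * (p == q)%:R *+ (p == i).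
  rewrite expr2 scalerAr hessian_mulX !fps_coefZ !fps_coefXU.
  have [->|_] := eqVneq p i; last by rewrite mulr0 mul0rn addr0.
  rewrite eq_sym; case: eqP => _; rewrite ?mulr0 ?addr0 // !mulr1.
  by rewrite mulr_natl.
under eq_bigr do rewrite e.
rewrite big_mkcond /=; under eq_bigr => i _.
  rewrite (_ : (if _ then _ else 0) = (if (i < k)%N then 2%:R * a i * (p == q)%:R else 0) *+ (p == i)).
    over.
  by case: ifP; rewrite ?mul0rn.
rewrite sumr_delta !mxE; case: ifP => _; first by rewrite -mulrA mulr_natr.
by rewrite mul0rn mulr0.
Qed.

Lemma split_form_subst m (sigma : psub K n m) a g :
  fps_subst sigma (split_form a g) =
  \sum_i head_diag a 0 i *: sigma i ^+ 2 + fps_subst sigma (tail g).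
Proof.
rewrite split_form_val rmorphD rmorph_sum /= big_mkcond; congr (_ + _).
apply: eq_bigr => i _; rewrite mxE; case: ifP => _; last by rewrite scale0r.
by rewrite linearZ rmorphXn /= fps_substX.
Qed.

(** Write q and q' for the two sums of squares. The linear part [L] of the
    coordinate change [phi] is an isometry between them. On the locus where
    phi_i = - L_i for i < k, the squares in q(phi) and in q' have the same sum and
    can be cancelled; the sign makes this locus a graph over the remaining
    variables, since phi_i + L_i has linear part 2 L_i. *)
Lemma splitting_unique a a' g g' : fps_ord 3 g -> fps_ord 3 g' ->
    (forall i : 'I_n, (i < k)%N -> a' i != 0) ->
    right_equiv (split_form a g) (split_form a' g') ->
  right_equiv g g'.
Proof.
move=> og og' nza' /right_equivP[phi [aphi uL ephi]].
pose L := jac phi; pose D := head_diag a; pose D' := head_diag a'.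
have o2 : fps_ord 2 (split_form a g).
  rewrite split_form_val; apply: fps_ordD.
    by apply: fps_ord_sum => i _; apply: fps_ordZ; apply: (fps_ordM (fps_ord_X _ _) (fps_ord_X _ _)).
  by apply: fps_ord_subst; apply: fps_ordW og.
have isoL : L^T *m diag_mx D *m L = diag_mx D'.
  have := hessian_split a' og'; rewrite -ephi hessian_subst // hessian_split //.
  rewrite -scalemxAr -scalemxAl => /(congr1 ( *:%R 2%:R^-1)).
  by rewrite !scalerA mulVf // !scale1r.
have isoE p q : \sum_i L i p * D 0 i * L i q = D' 0 p *+ (p == q).
  have /matrixP/(_ p q) := isoL; rewrite mul_mx_diag [RHS]mxE => <-.
  by rewrite mxE; apply: eq_bigr => i _; rewrite [in RHS]mxE [in RHS]mxE.
have oPhi (i : 'I_n) : fps_ord 1 (if (i < k)%N then phi i + psub_mx L i else fps_X i).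
  case: ifP => _; last exact: fps_ord_X.
  by apply: fps_ordD; exact: psub_ord.
pose Phi : psub K n n := Psub oPhi.
have aPhi i : Phi i \in fps_alg.
  by rewrite /=; case: ifP => _; rewrite ?fps_algX // rpredD ?fps_alg_mx.
have jPhi (i j : 'I_n) : jac Phi i j = if (i < k)%N then 2%:R * L i j else (i == j)%:R.
  rewrite mxE /=; case: ifP => _; last exact: fps_coefXU.
  rewrite fps_coefD; have := jac_mx L; move/matrixP/(_ i j); rewrite mxE => ->.
  by rewrite /L mxE mulr_natl.
have uPhi : jac Phi \in unitmx.
  (* The first [k] rows of [jac Phi] are those of [2 L], and [L^T D L = D'] shows
     how to recover the first [k] coordinates from them. *)
  pose N := \matrix_(i, j) (if (i < k)%N then (2%:R * a' i)^-1 * (L j i * D 0 j)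
                            else (i == j)%:R).
  suff /mulmx1_unit[_ u] : N *m jac Phi = 1%:M by exact: u.
  apply/matrixP=> p q; rewrite mxE [RHS]mxE; have [lt|ge] := boolP (p < k)%N.
    have nz : 2%:R * a' p != 0 by rewrite mulf_neq0 // nza'.
    transitivity ((2%:R * a' p)^-1 * (2%:R * \sum_i L i p * D 0 i * L i q)).
      rewrite !mulr_sumr; apply: eq_bigr => i _; rewrite [N _ _]mxE lt jPhi.
      rewrite -!mulrA; congr (_ * _); have [_|gei] := boolP (i < k)%N.
        by rewrite (mulrCA (D 0 i)) (mulrCA (L i p) 2%:R).
      by rewrite [D 0 i]mxE (negbTE gei) !(mul0r, mulr0).
    by rewrite isoE [D' 0 p]mxE lt mulrnAr mulrnAr mulVf.
  rewrite (bigD1 p) //= big1 ?addr0 => [|i ne]; last first.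
    by rewrite [N _ _]mxE (negbTE ge) eq_sym (negbTE ne) mul0r.
  by rewrite [N _ _]mxE (negbTE ge) eqxx mul1r jPhi (negbTE ge).
have [G [aG _ canG _]] := fps_alg_inverse_function uPhi aPhi.
have GPhi i : fps_subst G (Phi i) = fps_X i by rewrite -fps_substX canG.
(* [sigma] parametrises the locus by the last variables. *)
pose sigma := psub_comp G (psub_rest K n k).
have asigma i : sigma i \in fps_alg by apply: fps_alg_subst => //; exact: fps_alg_rest.
have sigma_tl j : sigma (tl j) = fps_X j.
  have := GPhi (tl j); rewrite /= tail_ord_ge fps_substX => ->.
  by rewrite fps_substX psub_rest_tail.
have sigma_hd (i : 'I_n) : (i < k)%N ->
    fps_subst sigma (phi i) = - \sum_l L i l *: sigma l.
  move=> lt; apply/eqP; rewrite -addr_eq0; apply/eqP.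
  have -> : \sum_l L i l *: sigma l = fps_subst sigma (psub_mx L i).
    rewrite -[psub_mx L i]/(\sum_l L i l *: fps_X l) rmorph_sum.
    by apply: eq_bigr => l _; rewrite -(fps_substX sigma) /= linearZ.
  rewrite -rmorphD; have := GPhi i; rewrite /= lt psub_compE => ->.
  by rewrite fps_substX psub_rest_head.
have sigma_tail h : fps_subst sigma (tail h) = h.
  by apply: fps_subst_cancel => j; rewrite fps_substX sigma_tl.
pose eta := psub_comp (psub_comp (psub_tail K n k) phi) sigma.
have e_eta : fps_subst eta g = g'.
  have := congr1 (fps_subst sigma) ephi.
  rewrite -psub_compE !split_form_subst sigma_tail !psub_compE.
  suff -> : \sum_i D 0 i *: (psub_comp phi sigma i) ^+ 2 =
            \sum_i D' 0 i *: sigma i ^+ 2 by move/addrI.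
  transitivity (\sum_i D 0 i *: (\sum_l L i l *: sigma l) ^+ 2).
    apply: eq_bigr => i _; have [lt|ge] := boolP (i < k)%N.
      by rewrite [psub_comp _ _ _]sigma_hd // sqrrN.
    by rewrite mxE (negbTE ge) !scale0r.
  transitivity (\sum_p \sum_q \sum_i (L i p * D 0 i * L i q) *: (sigma p * sigma q)).
    rewrite [RHS](eq_bigr (fun p => \sum_i \sum_q
      (L i p * D 0 i * L i q) *: (sigma p * sigma q))) => [|p _]; last exact: exchange_big.
    rewrite exchange_big; apply: eq_bigr => i _; rewrite expr2 mulr_suml scaler_sumr.
    apply: eq_bigr => p _; rewrite mulr_sumr scaler_sumr; apply: eq_bigr => q _.
    by rewrite -scalerAr -scalerAl !scalerA [_ * L i p]mulrC mulrA.
  apply: eq_bigr => p _; under eq_bigr do rewrite -scaler_suml isoE.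
  rewrite (bigD1 p) //= big1 ?addr0 => [|q ne].
    by rewrite eqxx mulr1n -expr2.
  by rewrite eq_sym (negbTE ne) mulr0n scale0r.
pose S := jac sigma.
(* Linear part of the equations of the locus: [L S = - L S] in the first rows. *)
have LS0 (i : 'I_n) j : (i < k)%N -> (L *m S) i j = 0.
  move=> lt; have e : (L *m S) i j = - (L *m S) i j.
    transitivity (jac (psub_comp phi sigma) i j); first by rewrite jac_compE.
    rewrite [LHS]mxE [psub_comp _ _ _]sigma_hd // fps_coefN fps_coef_sum.
    by rewrite [in RHS]mxE; congr (- _); apply: eq_bigr => l _; rewrite fps_coefZ [S _ _]mxE.
  apply/eqP; have /eqP : (L *m S) i j *+ 2 = 0 by rewrite mulr2n {1}e addNr.
  by rewrite -mulr_natr mulf_eq0 (negbTE nz2) orbF.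
have ueta : jac eta \in unitmx.
  pose M := \matrix_(i, j) (invmx L (tl i) (tl j)) : 'M[K]_(n - k).
  suff /mulmx1_unit[_ u] : M *m jac eta = 1%:M by exact: u.
  apply/matrixP=> i j; rewrite mxE [RHS]mxE.
  have <- : S (tl i) j = (i == j)%:R by rewrite mxE sigma_tl fps_coefXU.
  rewrite -[S](mulKmx uL) [RHS]mxE (bigID (fun l : 'I_n => (l < k)%N)) /=.
  rewrite [X in X + _]big1 ?add0r => [|l lt]; last by rewrite LS0 ?mulr0.
  rewrite tail_sum; apply: eq_bigr => l _; rewrite [M _ _]mxE; congr (_ * _).
  by rewrite /L /S -jac_compE [LHS]mxE [RHS]mxE /= fps_substX.
apply/right_equivP; exists eta; split=> //.
by do 2!apply: fps_alg_comp => //; move=> j; exact: fps_algX.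
Qed.

End Uniqueness.

Theorem theorem2p2 (K : fieldType) (hchar : 2%N \notin [pchar K])
    (n k : nat) (f : algps K n)
    (hf : idealX (@max_ideal K n) 2 f)
    (hrank : \rank (hessian f) = k) :
  (exists (a : 'I_n -> K) (g : algps K (n - k)), is_splitting f a g)
  /\ (forall (a a' : 'I_n -> K) (g g' : algps K (n - k)),
        is_splitting f a g -> is_splitting f a' g' -> right_equiv g g').
Proof.
have nz2 : (2%:R : K) != 0 by move: hchar; rewrite !inE.
split; first by apply: splitting_exists => //; apply/idealX_ordP.
move=> a a' g g' [_ /idealX_ordP og e] [nza' /idealX_ordP og' e'].
apply: splitting_unique nz2 _ _ _ _ og og' nza' _.
exact: right_equiv_trans (right_equiv_sym e) e'.
Qed.
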